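(* Let $G$ be a non-elementary relatively hyperbolic group. Then every finitely generated non-elementary subgroup $H\le G$ has uniform exponential growth, i.e. $$\inf\{\omega(H,S): S \text{ a finite symmetric generating set of } H\}>0 .$$
   Context: All groups whose growth is considered are finitely generated (in particular $G$ is finitely generated). Growth rate: for a group $H$ with finite symmetric generating set $S=S^{-1}$ and word metric $d_S$, put $S^{\le n}=\{h\in H: d_S(1,h)\le n\}$ and $\omega(H,S)=\lim_{n\to\infty}\frac{\log \sharp(S^{\le n})}{n}$, where $\sharp$ denotes cardinality. Relatively hyperbolic groups: $G$ is relatively hyperbolic if it admits a cusp-uniform action, that is, a proper isometric action on a proper geodesic Gromov-hyperbolic space $(X,d)$ such that $G$ does not fix a point of the Gromov boundary $\partial X$, and such that there is a $G$-invariant system $\mathbb U$ of pairwise disjoint open horoballs centered at the parabolic points of $G$ with $G$ acting co-compactly on $X(\mathbb U)=X\setminus\bigcup_{U\in\mathbb U}U$. (A parabolic subgroup is a subgroup whose limit set is a single point; that point is called a parabolic point.) One such action of $G$ on $X$ is fixed. The limit set $\Lambda H\subset\partial X$ of a subgroup $H\le G$ is the set of accumulation points in $\partial X$ of an $H$-orbit in $X$. A subgroup $H$ is non-elementary if $\Lambda H$ contains at least $3$ points; $G$ is non-elementary if $\Lambda G$ contains at least $3$ points. *)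

(* Defs.v *)
From HB Require Import structures.
From mathcomp Require Import all_boot all_order all_algebra finmap.
From mathcomp Require Import all_classical all_reals all_analysis.

Set Implicit Arguments.
Unset Strict Implicit.
Unset Printing Implicit Defensive.

Import Order.TTheory GRing.Theory Num.Theory.
Import numFieldNormedType.Exports.

Local Open Scope classical_set_scope.
Local Open Scope ring_scope.

Section Groups.
Variable G : groupType.
Local Open Scope group_scope.

Definition subgroup (H : set G) : Prop :=
  H 1 /\ forall x y, H x -> H y -> H (x * y^-1).

(* [smallest] is the intersection of all subgroups containing S *)
Definition generates (S H : set G) : Prop := smallest subgroup S = H.

Definition finitely_generated (H : set G) : Prop :=
  exists2 S : set G, finite_set S & generates S H.

Definition symmetric_set (S : set G) : Prop := [set s^-1 | s in S] = S.

Definition sym_gen_set (H S : set G) : Prop :=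
  [/\ finite_set S, symmetric_set S & generates S H].

(* the words in the alphabet S representing g *)
Definition words (S : set G) (g : G) : set (seq G) :=
  [set w | (forall s, s \in w -> S s) /\ \prod_(s <- w) s = g].

End Groups.

Section Growth.
Variables (R : realType) (G : groupType).

(* Real-valued; meaningful when g^-1 * h lies in the group generated by S
   (the infimum of the empty set is 0). *)
Definition word_dist (S : set G) (g h : G) : R :=
  inf [set (size w)%:R | w in words S (g^-1 * h)%g].

Definition word_ball (H S : set G) (n : nat) : set G :=
  [set h | H h /\ word_dist S 1%g h <= n%:R].

Definition growth_rate (H S : set G) : R :=
  limn (fun n : nat => ln (#|` fset_set (word_ball H S n) |)%:R / n%:R : R).

End Growth.

Section MetricSpaces.
Variables (R : realType) (X : metricType R).

Definition proper_space : Prop :=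
  forall (x : X) (r : R), compact [set y | mdist x y <= r].

Definition geodesic_space : Prop :=
  forall x y : X, exists c : R -> X,
    [/\ c 0 = x, c (mdist x y) = y &
        forall s t, 0 <= s <= mdist x y -> 0 <= t <= mdist x y ->
          mdist (c s) (c t) = `|s - t|].

Definition gromov_product (o x y : X) : R :=
  (mdist o x + mdist o y - mdist x y) / 2.

Definition gromov_hyperbolic : Prop :=
  exists delta : R, forall o x y z : X,
    Num.min (gromov_product o x y) (gromov_product o y z) - delta
      <= gromov_product o x z.

(* (x_i | y_j)_o tends to infinity as i, j tend to infinity; this does not
   depend on the base point o. *)
Definition same_end (x y : nat -> X) : Prop :=
  forall (o : X) (M : R), exists N : nat, forall i j : nat,
    (N <= i)%N -> (N <= j)%N -> M <= gromov_product o (x i) (y j).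

Definition gromov_sequence (x : nat -> X) : Prop := same_end x x.

(* The Gromov boundary. A boundary point is an equivalence class of Gromov
   sequences; a sequence x of points of X converges to the boundary point xi
   in the compactification of X if and only if x belongs to the class xi. *)
Definition boundary : set (set (nat -> X)) :=
  [set xi | exists2 x, gromov_sequence x &
              xi = [set y | gromov_sequence y /\ same_end x y]].

Definition geodesic_ray (c : R -> X) : Prop :=
  forall s t, 0 <= s -> 0 <= t -> mdist (c s) (c t) = `|s - t|.

Definition ray_to (c : R -> X) (xi : set (nat -> X)) : Prop :=
  geodesic_ray c /\ xi (fun n : nat => c n%:R).

Definition busemann (c : R -> X) (x : X) : R :=
  lim ((mdist x (c t) - t : R) @[t --> +oo%R]).

(* In a Gromov-hyperbolic space the Busemann functions of two rays to xi agree
   only up to additive constants and bounded errors, so, as usual in this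
   setting, horoballs are sublevel sets of a Busemann function up to a bounded
   error. With exact sublevel sets, invariance of a horoball under the
   stabilizer of its center would be an unduly strong requirement. *)
Definition open_horoball (xi : set (nat -> X)) (U : set X) : Prop :=
  open U /\
  exists c : R -> X, ray_to c xi /\
    exists C : R, [set x | busemann c x < - C] `<=` U /\
                  U `<=` [set x | busemann c x < C].

End MetricSpaces.

Arguments boundary {R} X.
Arguments proper_space {R} X.
Arguments geodesic_space {R} X.
Arguments gromov_hyperbolic {R} X.

Section Actions.
Variables (R : realType) (G : groupType) (X : metricType R).
Variable act : G -> X -> X.

Definition isometric_action : Prop :=
  [/\ forall x, act 1%g x = x,
      forall g h x, act (g * h)%g x = act g (act h x) &
      forall g x y, mdist (act g x) (act g y) = mdist x y].

Definition proper_action : Prop :=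
  forall K : set X, compact K ->
    finite_set [set g | (act g @` K) `&` K !=set0].

Definition boundary_act (g : G) (xi : set (nat -> X)) : set (nat -> X) :=
  [set (act g \o x) | x in xi].

Definition limit_set (H : set G) : set (set (nat -> X)) :=
  [set xi | boundary X xi /\
     exists (o : X) (h : nat -> G),
       (forall n, H (h n)) /\ xi (fun n => act (h n) o)].

Definition non_elementary (H : set G) : Prop := (`I_3 #<= limit_set H)%card.

Definition parabolic_point (xi : set (nat -> X)) : Prop :=
  exists2 P : set G, subgroup P & limit_set P = [set xi].

Definition horoball_system (UU : set (set X)) : Prop :=
  [/\ forall U, UU U -> exists2 xi, parabolic_point xi & open_horoball xi U,
      forall xi, parabolic_point xi -> exists2 U, UU U & open_horoball xi U,
      forall U V, UU U -> UU V -> U <> V -> U `&` V = set0 &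
      forall g U, UU U -> UU (act g @` U)].

Definition cocompact_on (Y : set X) : Prop :=
  exists K : set X, [/\ compact K, K `<=` Y &
    forall y, Y y -> exists (g : G) (k : X), K k /\ act g k = y].

Definition cusp_uniform : Prop :=
  [/\ [/\ proper_space X, geodesic_space X & gromov_hyperbolic X],
      isometric_action,
      proper_action,
      ~ (exists2 xi, boundary X xi & forall g, boundary_act g xi = xi) &
      exists2 UU : set (set X), horoball_system UU &
        cocompact_on (~` \bigcup_(U in UU) U)].

End Actions.

(* Main.v *)
(** Xie's theorem. Let [delta] be a hyperbolicity constant. For a fixed length
    [L0] there is a uniform [M] such that, for every finite symmetric generating
    set [S] of a non-elementary [H], the ball [S^{<=M}] displaces every point of
    [X] by more than [L0]. Indeed a point moved little by the whole ball either
    lies deep in a horoball, which [S] then preserves, so that the limit set of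
    [H] is a single point; or it lies near the cocompact part, and then
    properness bounds the size of the ball, whereas a ball of radius [M] of an
    infinite group has more than [M] elements.

    If [L0] is large compared to [delta], large displacement at every point
    forces a product [g] of at most two elements of the ball to translate a
    quasi-axis. If some [s] in [S] moves this axis away from itself, then
    [g^(+-9)] and [s g^(+-9) s^-1], for suitable signs, play ping-pong on
    half-spaces orthogonal to the two axes and generate a free semigroup; this
    bounds the growth rate below by [ln 2] over a uniform length. Otherwise [H]
    stays at bounded distance from the axis and has at most two limit points. *)
Require Import Defs.
From mathcomp Require Import all_boot all_order all_algebra finmap.
From mathcomp Require Import all_classical all_reals all_analysis.
From mathcomp Require Import lra zify.

Set Implicit Arguments.
Unset Strict Implicit.
Unset Printing Implicit Defensive.

Import Order.TTheory GRing.Theory Num.Theory.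
Import numFieldNormedType.Exports.

Local Open Scope classical_set_scope.
Local Open Scope ring_scope.

(** * Gromov products and the four-point condition *)

Section Hyperbolic.
Variables (R : realType) (X : metricType R).
Implicit Types (x y z w o : X) (a b : int -> X) (delta l : R).

Local Notation d := (@mdist R X).
Local Notation gp := (@gromov_product R X).

Lemma mdistC x y : d x y = d y x. Proof. exact: metric_sym. Qed.

Lemma mdist_tri y x z : d x z <= d x y + d y z. Proof. exact: metric_triangle. Qed.

(** [delta] is taken positive because all lengths are compared with multiples of it and the descent
    in [exists_axis_pair] divides by it. *)
Definition hyperbolic_with delta : Prop :=
  0 < delta /\ forall o x y z,
    Num.min (gp o x y) (gp o y z) - delta <= gp o x z.

Lemma gromov_hyperbolic_with :
  gromov_hyperbolic X -> exists delta, hyperbolic_with delta.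
Proof.
move=> [delta hyp]; exists (Num.max delta 1); split=> [|o x y z].
  by rewrite lt_max ltr01 orbT.
apply: le_trans (hyp o x y z).
by rewrite lerD2l lerN2 le_max lexx.
Qed.

Lemma gpC o x y : gp o x y = gp o y x.
Proof. by rewrite /gromov_product (mdistC x y) [d o x + _]addrC. Qed.

Lemma gpxx o x : gp o x x = d o x.
Proof. by rewrite /gromov_product mdistxx; lra. Qed.

Lemma gp_base x y : gp x x y = 0.
Proof. by rewrite /gromov_product mdistxx; lra. Qed.

Lemma gp_swap x y z : gp x y z = d x y - gp y x z.
Proof. by rewrite /gromov_product (mdistC y x); lra. Qed.

Lemma gp_rebase x y z w :
  gp y z w = gp x z w + d x y - gp x z y - gp x w y.
Proof.
by rewrite /gromov_product (mdistC y z) (mdistC y w); lra.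
Qed.

Lemma gp_diff o x y z : gp o x y - d y z <= gp o x z.
Proof.
rewrite /gromov_product.
have := mdist_tri z o y; have := mdist_tri y x z.
rewrite (mdistC z y); lra.
Qed.

Lemma gp_base_diff o p x y : gp o x y - d o p <= gp p x y.
Proof.
rewrite /gromov_product.
have := mdist_tri p o x; have := mdist_tri p o y; lra.
Qed.

Variable delta : R.
Hypothesis hypX : hyperbolic_with delta.

Let delta_gt0 : 0 < delta. Proof. by case: hypX. Qed.

Lemma gp_hyp o x y z :
  gp o x y - delta <= gp o x z \/ gp o y z - delta <= gp o x z.
Proof.
case: hypX => _ /(_ o x y z); rewrite minEle.
by case: ifP => _; [left|right].
Qed.

Lemma four_point x y z w :
  d x z + d y w <= d x y + d z w + 2 * delta \/
  d x z + d y w <= d x w + d y z + 2 * delta.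
Proof.
have := gp_hyp w x y z; rewrite /gromov_product.
rewrite (mdistC w x) (mdistC w y) (mdistC w z).
by case=> H; [left|right]; lra.
Qed.

(** * Quasi-axes *)

(* The last condition bounds the Gromov product of the neighbours of [a (i + 1)],
   based at [a (i + 1)], by [8 * delta]. *)
Definition axis l a : Prop :=
  [/\ 1000 * delta <= l,
      forall i, d (a i) (a (i + 1)) = l &
      forall i, 2 * l - 16 * delta <= d (a i) (a (i + 2))].

Definition flip a : int -> X := fun i => a (- i).

Lemma axis_flip l a : axis l a -> axis l (flip a).
Proof.
move=> [l_ge a1 a2]; split=> // i; rewrite /flip mdistC.
  by rewrite -(a1 (- (i + 1))); congr (d _ (a _)); lia.
rewrite (_ : - i = - (i + 2) + 2) //; by lia.
Qed.

Section OneAxis.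
Variables (l : R) (a : int -> X).
Hypothesis ax : axis l a.

Local Notation k := (l - 18 * delta).

(** The four-point condition for [z] and three consecutive points; [k] is what is left of
    [2 * l - 16 * delta] after subtracting [l + 2 * delta]. *)
Lemma axis_convex z i :
  d z (a i) <= d z (a (i - 1)) - k \/ d z (a i) <= d z (a (i + 1)) - k.
Proof.
case: ax => l_ge a1 a2.
have e1 := a1 i; have e0 := a1 (i - 1); have e2 := a2 (i - 1).
have := four_point z (a (i - 1)) (a i) (a (i + 1)).
rewrite (_ : i - 1 + 1 = i) in e0; last by lia.
rewrite (_ : i - 1 + 2 = i + 1) in e2; last by lia.
by case=> H; [left|right]; lra.
Qed.

(** If the left alternative of [axis_convex] fails at [i], the right one raises the distance by [k],
    so the left one fails at [i + 1] too, and so on. *)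
Lemma axis_grow_step z i (n : nat) : d z (a (i - 1)) - k < d z (a i) ->
  d z (a (i + n%:Z)) + k <= d z (a (i + n.+1%:Z)).
Proof.
case: (ax) => l_ge _ _ H; have d0 := delta_gt0.
have step j : d z (a (j - 1)) - k < d z (a j) ->
    d z (a j) + k <= d z (a (j + 1)).
  by case: (axis_convex z j) => ?; lra.
elim: n => [|n IH]; first by rewrite addr0; apply: step.
rewrite (_ : i + n.+2%:Z = i + n.+1%:Z + 1); last by lia.
apply: step; rewrite (_ : i + n.+1%:Z - 1 = i + n%:Z); last by lia.
lra.
Qed.

Lemma axis_grow z i (n : nat) : d z (a (i - 1)) - k < d z (a i) ->
  d z (a i) + k * n%:R <= d z (a (i + n%:Z)).
Proof.
move=> H; elim: n => [|n IH]; first by rewrite mulr0 !addr0.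
by apply: le_trans (axis_grow_step n H); rewrite -natr1; lra.
Qed.

End OneAxis.

Section OneAxisSym.
Variables (l : R) (a : int -> X).
Hypothesis ax : axis l a.

Local Notation k := (l - 18 * delta).

Lemma axis_grow_back z i (n : nat) : d z (a (i + 1)) - k < d z (a i) ->
  d z (a i) + k * n%:R <= d z (a (i - n%:Z)).
Proof.
have := @axis_grow _ _ (axis_flip ax) z (- i) n; rewrite /flip opprK.
rewrite (_ : - (- i - 1) = i + 1); last by lia.
by rewrite (_ : - (- i + n%:Z) = i - n%:Z); last by lia.
Qed.

Lemma axis_dist_step i (n : nat) :
  d (a i) (a (i + n%:Z)) + k <= d (a i) (a (i + n.+1%:Z)).
Proof.
have d0 := delta_gt0; case: (ax) => l_ge a1 _.
case: n => [|n]; first by rewrite addr0 mdistxx a1; lra.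
have := @axis_grow_step _ _ ax (a i) (i + 1) n.
rewrite (_ : i + 1 - 1 = i) ?a1 ?mdistxx; last by lia.
rewrite (_ : i + 1 + n%:Z = i + n.+1%:Z); last by lia.
rewrite (_ : i + 1 + n.+1%:Z = i + n.+2%:Z); last by lia.
by apply; lra.
Qed.

Lemma axis_dist_lb i (n : nat) : k * n%:R <= d (a i) (a (i + n%:Z)).
Proof.
elim: n => [|n IH]; first by rewrite mulr0 mdist_ge0.
by apply: le_trans (axis_dist_step i n); rewrite -natr1; lra.
Qed.

Lemma axis_dist_lb' i (n : nat) : k * n%:R <= d (a i) (a (i - n%:Z)).
Proof.
rewrite mdistC; have := axis_dist_lb (i - n%:Z) n.
by rewrite (_ : i - n%:Z + n%:Z = i) //; lia.
Qed.

Lemma axis_dist_ub i (n : nat) : d (a i) (a (i + n%:Z)) <= l * n%:R.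
Proof.
case: ax => _ a1 _; elim: n => [|n IH]; first by rewrite addr0 mdistxx mulr0.
apply: le_trans (mdist_tri (a (i + n%:Z)) _ _) _.
have := a1 (i + n%:Z); rewrite (_ : i + n%:Z + 1 = i + n.+1%:Z); last by lia.
by move=> ->; rewrite -natr1; lra.
Qed.

Lemma axis_dist_ub' i (n : nat) : d (a i) (a (i - n%:Z)) <= l * n%:R.
Proof.
rewrite mdistC; have := axis_dist_ub (i - n%:Z) n.
by rewrite (_ : i - n%:Z + n%:Z = i) //; lia.
Qed.

End OneAxisSym.

(** The neighbours of [a j] have product at most [8 * delta], and a far point has product at least
    [l - 9 * delta] with the neighbour on its side ([near]); two uses of hyperbolicity cost
    [2 * delta]. *)
Lemma axis_between l a j (m n : nat) : axis l a ->
  gp (a j) (a (j - m%:Z)) (a (j + n%:Z)) <= 10 * delta.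
Proof.
move=> ax; case: (ax) => l_ge a1 a2; have d0 := delta_gt0.
have near b i p : axis l b ->
    l - 9 * delta <= gp (b i) (b (i - 1)) (b (i - p.+1%:Z)).
  move=> bx; case: (bx) => _ b1 _.
  have := b1 (i - 1); have := axis_dist_step bx (i - p.+1%:Z) p.
  rewrite /gromov_product (_ : i - p.+1%:Z + p.+1%:Z = i); last by lia.
  rewrite (_ : i - p.+1%:Z + p%:Z = i - 1); last by lia.
  rewrite (_ : i - 1 + 1 = i); last by lia.
  rewrite (mdistC (b i)) (mdistC (b i)) (mdistC (b (i - 1)) (b (_ - _%:Z))); lra.
case: m => [|m]; first by rewrite subr0 gp_base; lra.
case: n => [|n]; first by rewrite addr0 gpC gp_base; lra.
have H1 := near _ j m ax; have H2 := near _ (- j) n (axis_flip ax).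
move: H2; rewrite /flip opprK (_ : - (- j - 1) = j + 1); last by lia.
rewrite (_ : - (- j - n.+1%:Z) = j + n.+1%:Z); last by lia.
move=> H2; have H3 : gp (a j) (a (j - 1)) (a (j + 1)) <= 8 * delta.
  rewrite /gromov_product; have := a2 (j - 1); have := a1 (j - 1).
  rewrite (a1 j) (_ : j - 1 + 1 = j); last by lia.
  rewrite (_ : j - 1 + 2 = j + 1); last by lia.
  by rewrite mdistC; lra.
have := gp_hyp (a j) (a (j - 1)) (a (j + n.+1%:Z)) (a (j + 1)).
have := gp_hyp (a j) (a (j - 1)) (a (j - m.+1%:Z)) (a (j + n.+1%:Z)).
rewrite (gpC _ (a (j + n.+1%:Z)) (a (j + 1))).
by case=> ? [] ?; lra.
Qed.
End Hyperbolic.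

Lemma natr_gt (R : realType) (x : R) : exists n : nat, x < n%:R.
Proof.
by exists (Num.bound `|x|); apply: le_lt_trans (ler_norm x) (archi_boundP (normr_ge0 x)).
Qed.

Lemma int_range_argmin (R : realType) (f : int -> R) (n : nat) :
  exists i : int, forall j : int, - n%:Z <= j <= n%:Z -> f i <= f j.
Proof.
elim: n => [|n [i IH]].
  by exists 0 => j j0; have -> : j = 0 by lia.
have [m [m1 m2]] : exists m, f m <= f n.+1%:Z /\ f m <= f (- n.+1%:Z).
  have [H|/ltW H] := leP (f n.+1%:Z) (f (- n.+1%:Z)).
    by exists n.+1%:Z.
  by exists (- n.+1%:Z).
have [m' [m1' m2']] : exists m', f m' <= f m /\ f m' <= f i.
  by have [H|/ltW H] := leP (f i) (f m); [exists i|exists m].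
exists m' => j jn.
have [/IH H|jn'] := boolP (- n%:Z <= j <= n%:Z); first exact: le_trans H.
have [->|->] : j = n.+1%:Z \/ j = - n.+1%:Z by lia.
  exact: le_trans m1.
exact: le_trans m2.
Qed.

(** * Nearest-point projections and half-spaces *)

Section HalfSpaces.
Variables (R : realType) (X : metricType R) (delta l : R).
Hypothesis hypX : hyperbolic_with X delta.
Implicit Types (x y z w : X) (a b : int -> X).

Local Notation d := (@mdist R X).
Local Notation gp := (@gromov_product R X).
Local Notation k := (l - 18 * delta).

Let delta_gt0 : 0 < delta. Proof. by case: hypX. Qed.

Definition nearest a z (i : int) := forall j, d z (a i) <= d z (a j).

(** Distances grow linearly along the axis, so a minimum over a long enough interval of indices is
    global. *)
Lemma nearest_exists a z : axis delta l a -> exists i, nearest a z i.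
Proof.
move=> ax; have d0 := delta_gt0; case: (ax) => l_ge _ _.
have k0 : 0 < k by lra.
have [n] := natr_gt (2 * d z (a 0) / k); rewrite ltr_pdivrMr // => nP.
have [i iP] := int_range_argmin (fun j => d z (a j)) n.
exists i => j; have [|jn] := boolP (- n%:Z <= j <= n%:Z); first exact: iP.
have [m [mn e]] : exists m : nat, (n <= m)%N /\ (j = 0 + m%:Z \/ j = 0 - m%:Z).
  by exists `|j|%N; lia.
have : k * m%:R <= d (a 0) (a j).
  by case: e => ->; [apply: (axis_dist_lb hypX ax)|apply: (axis_dist_lb' hypX ax)].
have : n%:R * k <= k * m%:R by rewrite mulrC ler_pM2l // ler_nat.
have i0 : d z (a i) <= d z (a 0) by apply: iP; lia.
have := mdist_tri z (a 0) (a j); rewrite (mdistC (a 0) z); lra.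
Qed.

Lemma nearest_flip a z i : nearest a z i -> nearest (flip a) z (- i).
Proof. by move=> H j; rewrite /flip opprK. Qed.

(** Two steps on, the distance to [z] has already grown, so the product with [a (i + 2)] is at most
    [l - k / 2]; all later points lie in the direction of [a (i + 2)] as seen from [a i]. *)
Lemma nearest_gp_fwd a z i (n : nat) : axis delta l a -> nearest a z i ->
  gp (a i) z (a (i + n%:Z)) <= l.
Proof.
move=> ax H; have d0 := delta_gt0; case: (ax) => l_ge a1 _.
case: n => [|[|n]].
- by rewrite addr0 gpC gp_base; lra.
- rewrite /gromov_product a1; have := H (i + 1); rewrite (mdistC (a i) z); lra.
have c1 : d z (a i) + k <= d z (a (i + 2%:Z)).
  have := @axis_grow_step _ _ _ hypX _ _ ax z (i + 1) 0.
  rewrite addr0 (_ : i + 1 - 1 = i); last by lia.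
  rewrite (_ : i + 1 + 1%:Z = i + 2%:Z); last by lia.
  have := H (i + 1); lra.
have c2 : gp (a i) z (a (i + 2%:Z)) <= 2 * l / 2 - k / 2.
  rewrite /gromov_product; have := axis_dist_ub hypX ax i 2.
  by rewrite (mdistC (a i) z); lra.
have := axis_between hypX (i + 2%:Z) 2 n ax.
rewrite (_ : i + 2%:Z - 2%:Z = i); last by lia.
rewrite (_ : i + 2%:Z + n%:Z = i + n.+2%:Z); last by lia.
have := axis_dist_lb hypX ax i 2.
have := gp_swap (a i) (a (i + 2%:Z)) (a (i + n.+2%:Z)).
have := gp_hyp hypX (a i) z (a (i + n.+2%:Z)) (a (i + 2%:Z)).
rewrite (gpC _ (a (i + n.+2%:Z)) (a (i + 2%:Z))).
by case=> ?; lra.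
Qed.

Lemma nearest_gp a z i j : axis delta l a -> nearest a z i ->
  gp (a i) z (a j) <= l.
Proof.
move=> ax H; have [n [e|e]] : exists n : nat, j = i + n%:Z \/ j = i - n%:Z.
  by exists `|j - i|%N; lia.
- by rewrite e; apply: nearest_gp_fwd.
- have := nearest_gp_fwd n (axis_flip hypX ax) (nearest_flip H).
  by rewrite /flip opprK (_ : - (- i + n%:Z) = j) //; lia.
Qed.

(** Add the bounds of [nearest_gp] for [p] and [q], and use the triangle inequality through the
    nearest point [a i]. *)
Lemma near_axis a z p q c : axis delta l a -> gp z (a p) (a q) <= c ->
  exists i, d z (a i) <= c + 2 * l.
Proof.
move=> ax + ; have [i H] := nearest_exists z ax => cz; exists i; move: cz.
have := nearest_gp p ax H; have := nearest_gp q ax H.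
rewrite /gromov_product (mdistC (a i) z).
have := mdist_tri (a i) (a p) (a q); rewrite (mdistC (a p) (a i)); lra.
Qed.

(** The positive side of the bisector of [a (i - 1)] and [a i], in the role of a half-space
    orthogonal to the axis. *)
Definition halfspace a i : set X := [set z | d z (a i) < d z (a (i - 1))].

Lemma halfspace_shrink a z i (n : nat) : axis delta l a ->
  halfspace a i z -> halfspace a (i - n%:Z) z.
Proof.
move=> ax; rewrite /halfspace /= => H; have d0 := delta_gt0.
case: (ax) => l_ge _ _; case: n => [|n]; first by rewrite subr0.
have [H1|//] := leP (d z (a (i - n.+1%:Z - 1))) (d z (a (i - n.+1%:Z))).
have := @axis_grow_step _ _ _ hypX _ _ ax z (i - n.+1%:Z) n.
rewrite (_ : i - n.+1%:Z + n%:Z = i - 1); last by lia.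
rewrite (_ : i - n.+1%:Z + n.+1%:Z = i); last by lia.
lra.
Qed.

Lemma halfspace_gp a z i (n : nat) : axis delta l a ->
  halfspace a (i + n%:Z + 1) z -> k * n%:R <= gp (a i) z (a (i + n%:Z)).
Proof.
move=> ax; rewrite /halfspace /= (_ : i + n%:Z + 1 - 1 = i + n%:Z); last by lia.
move=> H; have d0 := delta_gt0; case: (ax) => l_ge _ _.
have := @axis_grow_back _ _ _ hypX _ _ ax z (i + n%:Z) n.
rewrite (_ : i + n%:Z - n%:Z = i); last by lia.
have := axis_dist_lb hypX ax i n; rewrite /gromov_product (mdistC (a i) z); lra.
Qed.

(* The projection of [a N] to the axis [b] projects back to the axis [a] well
   before [a N], i.e. [a] leaves [b] in the positive direction. *)
Section Diverging.
Variables (a b : int -> X) (N i h : int).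
Hypotheses (axa : axis delta l a) (axb : axis delta l b).
Hypotheses (bN : nearest b (a N) h) (ai : nearest a (b h) i).
Hypothesis Ni : i + 4%:Z <= N.

Let l_ge : 1000 * delta <= l. Proof. by case: axa. Qed.

(** Seen from [a i], both [z] and [a N] lie in the direction of [a (i + 4)] and [b h] does not.
    Rebased at [b h], [z] and [a N] share a long direction, so [z] inherits the bound that [a N] has
    because it projects to [b h]. *)
Lemma diverging_gp z j : halfspace a (i + 5%:Z) z -> gp (b h) z (b j) <= l + delta.
Proof.
move=> Hz; have d0 := delta_gt0; have lg := l_ge.
have e1 : 4 * k <= gp (a i) z (a (i + 4%:Z)).
  have := @halfspace_gp a z i 4 axa; rewrite (_ : i + 4%:Z + 1 = i + 5%:Z); last by lia.
  by move=> /(_ Hz); lra.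
have e2 := nearest_gp (i + 4%:Z) axa ai.
have e3 : gp (a i) z (b h) <= l + delta.
  have := gp_hyp hypX (a i) z (b h) (a (i + 4%:Z)).
  have := gp_hyp hypX (a i) (b h) z (a (i + 4%:Z)).
  rewrite (gpC _ (b h) z); case=> ? [] ?; lra.
have e4 : 4 * k - 11 * delta <= gp (a i) z (a N).
  have [n e] : exists n : nat, N = i + 4%:Z + n%:Z by exists (absz (N - (i + 4%:Z))%R); lia.
  have := axis_between hypX (i + 4%:Z) 4 n axa.
  rewrite -e (_ : i + 4%:Z - 4%:Z = i); last by lia.
  have := gp_swap (a i) (a (i + 4%:Z)) (a N).
  have := axis_dist_lb hypX axa i 4.
  by have := gp_hyp hypX (a i) z (a (i + 4%:Z)) (a N); case=> ?; lra.
have e5 := nearest_gp N axa ai; have e6 := nearest_gp j axb bN.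
have e7 := gp_rebase (a i) (b h) z (a N); rewrite (gpC _ (a N) (b h)) in e7.
have := gp_hyp hypX (b h) (a N) z (b j); rewrite (gpC _ (a N) z).
by have := mdist_ge0 (a i) (b h); case=> ?; lra.
Qed.

Lemma diverging_sub : halfspace a (i + 5%:Z) `<=` halfspace b (h - 3%:Z).
Proof.
move=> z Hz; have := diverging_gp (h - 3%:Z) Hz.
rewrite /halfspace /= => H; have d0 := delta_gt0; have lg := l_ge.
have [H1|//] := leP (d z (b (h - 3%:Z - 1))) (d z (b (h - 3%:Z))).
have := @axis_grow _ _ _ hypX _ _ axb z (h - 3%:Z) 3.
rewrite (_ : h - 3%:Z + 3%:Z = h); last by lia.
have := axis_dist_lb' hypX axb h 3.
move: H; rewrite /gromov_product (mdistC (b h) z); lra.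
Qed.

Lemma diverging_disjoint : halfspace a (i + 5%:Z) `&` halfspace b (h + 4%:Z) = set0.
Proof.
apply/seteqP; split=> // z [Hz]; have := diverging_gp (h + 3%:Z) Hz.
rewrite /halfspace /= => H; have d0 := delta_gt0; have lg := l_ge.
rewrite (_ : h + 4%:Z - 1 = h + 3%:Z); last by lia.
have := @axis_grow_back _ _ _ hypX _ _ axb z (h + 3%:Z) 3.
rewrite (_ : h + 3%:Z - 3%:Z = h); last by lia.
rewrite (_ : h + 3%:Z + 1 = h + 4%:Z); last by lia.
have := axis_dist_lb hypX axb h 3.
move: H; rewrite /gromov_product (mdistC (b h) z); lra.
Qed.

(** A point [z] violating the reverse inclusion makes [b (h + 4)] and [a (i - 4)] lie in the same
    direction from [b h]; this cannot happen for both orientations of [b]. *)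
Lemma diverging_back z : ~ halfspace a (i - 4%:Z) z -> halfspace b (h + 5%:Z) z ->
  k + delta <= gp (b h) (b (h + 4%:Z)) (a (i - 4%:Z)).
Proof.
rewrite /halfspace /= => /negP; rewrite -leNgt => H Hz.
have d0 := delta_gt0; have lg := l_ge.
have := @axis_grow _ _ _ hypX _ _ axa z (i - 4%:Z) 4.
rewrite (_ : i - 4%:Z + 4%:Z = i); last by lia.
have := axis_dist_lb' hypX axa i 4 => e1 e2.
have e3 : 4 * k <= gp (a i) z (a (i - 4%:Z)).
  by rewrite /gromov_product (mdistC (a i) z); lra.
have e4 := nearest_gp (i - 4%:Z) axa ai.
have e5 : gp (a i) z (b h) <= l + delta.
  have := gp_hyp hypX (a i) (b h) z (a (i - 4%:Z)).
  rewrite (gpC _ (b h) z); case=> ?; lra.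
have e6 : 4 * k <= gp (b h) z (b (h + 4%:Z)).
  have := @halfspace_gp b z h 4 axb; rewrite (_ : h + 4%:Z + 1 = h + 5%:Z); last by lia.
  by move=> /(_ Hz); lra.
have e7 := gp_rebase (a i) (b h) z (a (i - 4%:Z)).
rewrite (gpC _ (a (i - 4%:Z)) (b h)) in e7.
have := gp_hyp hypX (b h) (b (h + 4%:Z)) z (a (i - 4%:Z)); rewrite (gpC _ _ z).
by have := mdist_ge0 (a i) (b h); case=> ?; lra.
Qed.

End Diverging.
End HalfSpaces.

(** * Ping-pong between two quasi-axes *)

Section PingPong.
Variables (R : realType) (X : metricType R) (delta l : R).
Hypothesis hypX : hyperbolic_with X delta.
Implicit Types (x y z w : X) (a b : int -> X).

Local Notation d := (@mdist R X).
Local Notation gp := (@gromov_product R X).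
Local Notation k := (l - 18 * delta).

Let delta_gt0 : 0 < delta. Proof. by case: hypX. Qed.

(** The indices [- 4] and [5] differ by 9: a translation by 9 along [a] carries the half-space at
    [i - 4], which contains both half-spaces at index [5], to the one at [i + 5]; likewise for
    [b]. *)
Definition pingpong a b := exists i h,
  [/\ halfspace a (i + 5%:Z) `<=` halfspace b (h - 4%:Z),
      halfspace b (h + 5%:Z) `<=` halfspace a (i - 4%:Z) &
      halfspace a (i + 5%:Z) `&` halfspace b (h + 5%:Z) = set0].

(** All conditions but the reverse inclusion hold for either orientation of [b]. If that inclusion
    failed for both, [b (h - 4)] and [b (h + 4)] would lie in one direction from [b h], against
    [axis_between]. *)
Lemma diverging_pingpong a b N i h : axis delta l a -> axis delta l b ->
  nearest b (a N) h -> nearest a (b h) i -> i + 4%:Z <= N ->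
  pingpong a b \/ pingpong a (flip b).
Proof.
move=> axa axb bN ai Ni; have d0 := delta_gt0; case: (axa) => l_ge _ _.
have pp c g : axis delta l c -> nearest c (a N) g -> nearest a (c g) i ->
    halfspace c (g + 5%:Z) `<=` halfspace a (i - 4%:Z) -> pingpong a c.
  move=> axc cN ci sub; exists i, g; split=> //.
    move=> z /(diverging_sub hypX axa axc cN ci Ni).
    rewrite (_ : g - 4%:Z = g - 3%:Z - 1%:Z); last by lia.
    by move=> cz; apply: (halfspace_shrink hypX _ axc cz).
  apply/seteqP; split=> // z [az cz].
  have <- := diverging_disjoint hypX axa axc cN ci Ni; split=> //.
  rewrite (_ : g + 4%:Z = g + 5%:Z - 1%:Z); last by lia.
  by apply: (halfspace_shrink hypX _ axc cz).
have axf := axis_flip hypX axb; have fN := nearest_flip bN.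
have fi : nearest a (flip b (- h)) i by rewrite /flip opprK.
have [sub|/existsNP[z1 /not_implyP[z1b z1a]]] :=
  pselect (halfspace b (h + 5%:Z) `<=` halfspace a (i - 4%:Z)).
  by left; apply: pp bN ai sub.
have [sub|/existsNP[z2 /not_implyP[z2b z2a]]] :=
  pselect (halfspace (flip b) (- h + 5%:Z) `<=` halfspace a (i - 4%:Z)).
  by right; apply: pp fN fi sub.
have := diverging_back hypX axa axb ai Ni z1a z1b.
have := diverging_back hypX axa axf fi Ni z2a z2b.
have := axis_between hypX h 4 4 axb.
rewrite /flip opprK (_ : - (- h + 4%:Z) = h - 4%:Z); last by lia.
have := gp_hyp hypX (b h) (b (h - 4%:Z)) (a (i - 4%:Z)) (b (h + 4%:Z)).
by rewrite (gpC _ (a _) (b _)) => H ? ? ?; clear Ni; exfalso; case: H => ?; lra.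
Qed.

(* If the nearest-point projections from [a] to [b] and back move every [a N]
   by at most 3 steps, then a far away [a N] would make the projection of the
   whole of [b] to [a] bounded. *)
Lemma axis_dichotomy a b : axis delta l a -> axis delta l b ->
  (forall N, exists h, d (a N) (b h) <= 20 * l) \/
  exists a' b', [/\ a' = a \/ a' = flip a, b' = b \/ b' = flip b & pingpong a' b'].
Proof.
move=> axa axb; have d0 := delta_gt0; case: (axa) => l_ge _ _.
have [|nopp] := pselect (exists a' b',
  [/\ a' = a \/ a' = flip a, b' = b \/ b' = flip b & pingpong a' b']).
  by right.
(* Outside this range, [a] or its flip would diverge from [b] and produce ping-pong. *)
left; have close N i h : nearest b (a N) h -> nearest a (b h) i ->
    (i - 3%:Z <= N <= i + 3%:Z)%R.
  move=> bN ai; have [H1|H1] := leP (i + 4%:Z) N.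
    by case: nopp; have [?|?] := diverging_pingpong axa axb bN ai H1;
      [exists a, b|exists a, (flip b)]; split; auto.
  have [H2|H2] := leP (- i + 4%:Z) (- N); last by lia.
  have bN' : nearest b (flip a (- N)) h by rewrite /flip opprK.
  case: nopp.
  have [?|?] := diverging_pingpong (axis_flip hypX axa) axb bN' (nearest_flip ai) H2;
    [exists (flip a), b|exists (flip a), (flip b)]; split; auto.
move=> N0; apply: contrapT => /forallNP far.
have [h0 bN0] := nearest_exists hypX (a N0) axb.
have [i0 ai0] := nearest_exists hypX (b h0) axa.
have c0 := close _ _ _ bN0 ai0.
have ub : d (a i0) (a N0) <= 3 * l.
  have [m [m3 e]] : exists m : nat, (m <= 3)%N /\ (N0 = i0 + m%:Z \/ N0 = i0 - m%:Z).
    by exists (absz (N0 - i0)%R); lia.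
  have H : d (a i0) (a N0) <= l * m%:R.
    by case: e => ->; [apply: (axis_dist_ub hypX axa)|apply: (axis_dist_ub' hypX axa)].
  apply: le_trans H _; rewrite mulrC ler_pM2r; last by lra.
  by rewrite (ler_nat R m 3).
have far' h : 17 * l < d (a i0) (b h).
  have /negP := far h; rewrite -ltNge.
  have := mdist_tri (a i0) (a N0) (b h); rewrite (mdistC (a N0) (a i0)); lra.
(* Ten steps, less an error of 3 at each end, keep [i] at least 4 beyond [i0]. *)
pose N := N0 + 10%:Z; have [h bN] := nearest_exists hypX (a N) axb.
have [i ai] := nearest_exists hypX (b h) axa.
have c := close _ _ _ bN ai.
have [m e] : exists m : nat, i = i0 + m.+4%:Z.
  by exists (absz (i - i0 - 4%:Z)%R); rewrite /N in c; lia.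
have e1 : 4 * k <= d (a i0) (a i).
  rewrite e; apply: le_trans (axis_dist_lb hypX axa i0 m.+4).
  rewrite mulrC ler_pM2l; last by lra.
  by rewrite (ler_nat R 4 m.+4).
have e2 := nearest_gp hypX i0 axa ai.
have e3 := nearest_gp hypX i axa ai0.
have e4 : 2 * (l + delta) <= gp (a i0) (b h) (a i).
  by rewrite gpC gp_swap gpC; lra.
(* From [a i0], [b h] lies in the direction of [a i] and [b h0] does not; hence [b] passes within
   [3 * l + delta] of [a i0], against [far']. *)
have e5 : gp (a i0) (b h0) (b h) <= l + delta.
  have := gp_hyp hypX (a i0) (b h0) (b h) (a i); case=> ?; lra.
have [j] := near_axis hypX axb e5.
by have := far' j; lra.
Qed.

End PingPong.

(** * Subadditive sequences *)

Section Fekete.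
Variables (R : realType) (u : nat -> R).
Hypotheses (u_ge0 : forall n, 0 <= u n) (uD : forall m n, u (m + n)%N <= u m + u n).

Lemma subadditive_mul m n : u (n * m)%N <= n%:R * u m + u 0%N.
Proof.
elim: n => [|n IH]; first by rewrite mul0n mul0r add0r.
by rewrite mulSn -natr1; apply: le_trans (uD _ _) _; lra.
Qed.

Lemma fekete : cvg ((u n / n%:R : R) @[n --> \oo]).
Proof.
(* Index 0 is left out: division by zero gives 0, which would spoil the infimum, the limit of the
   ratios. *)
pose E := [set u n / n%:R | n in [set n : nat | (0 < n)%N]].
have E_lb : has_lbound E.
  by exists 0 => _ [n _ <-]; rewrite divr_ge0.
have E0 : E !=set0 by exists (u 1%N / 1%:R), 1%N.
have infE n : (0 < n)%N -> inf E <= u n / n%:R.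
  by move=> n0; apply: ge_inf => //; exists n.
apply/cvg_ex; exists (inf E); apply/cvgrPdist_le => e e0.
have e20 : 0 < e / 2 by lra.
have [_ [m /= m0 <-] mE] := inf_adherent e20 (conj E0 E_lb).
have m0' : 0 < m%:R :> R by rewrite ltr0n.
(* [C] absorbs the error of [subadditive_mul] and the value at the remainder of the division by
   [m]. *)
pose C := u 0%N + (m%:R * u 1%N + u 0%N).
have rC r : (r < m)%N -> u r <= m%:R * u 1%N + u 0%N.
  move=> rm; have := subadditive_mul 1 r; rewrite muln1.
  have : r%:R * u 1%N <= m%:R * u 1%N by rewrite ler_wpM2r // ler_nat ltnW.
  lra.
have [N NP] := natr_gt (2 * C / e).
near=> n.
have n0 : (0 < n)%N by near: n; exists 1%N.
have n0' : 0 < n%:R :> R by rewrite ltr0n.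
have Nn : (N <= n)%N by near: n; exists N.
rewrite distrC ger0_norm ?subr_ge0 ?infE //.
suff : u n / n%:R <= u m / m%:R + e / 2 by lra.
rewrite ler_pdivrMr // mulrDl.
have h1 : u n <= (n %/ m)%:R * u m + C.
  have := uD (n %/ m * m) (n %% m); rewrite -divn_eq.
  have := subadditive_mul m (n %/ m); have := rC _ (ltn_pmod n m0).
  rewrite /C; lra.
have h2 : (n %/ m)%:R * u m <= u m / m%:R * n%:R.
  rewrite mulrAC ler_pdivlMr // [u m * _]mulrC mulrAC ler_wpM2r //.
  by rewrite -natrM ler_nat leq_divM.
have h3 : C <= e / 2 * n%:R.
  have : 2 * C / e <= n%:R by apply: le_trans (ltW NP) _; rewrite ler_nat.
  by rewrite ler_pdivrMr //; lra.
lra.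
Unshelve. all: by end_near.
Qed.

End Fekete.

(** * Word balls and free pairs *)

Section Words.
Variables (G : groupType).
Implicit Types (S H : set G) (g h u v : G).
Local Open Scope group_scope.

(** A form of the word ball without an infimum; [word_ballE] identifies the two. *)
Definition gball S n : set G := [set g | exists w : seq G,
  [/\ forall s, s \in w -> S s, (size w <= n)%N & \prod_(s <- w) s = g]].

Lemma gball1 S n : gball S n 1.
Proof. by exists [::]; split=> //; rewrite big_nil. Qed.

Lemma gballM S m n g h : gball S m g -> gball S n h -> gball S (m + n) (g * h).
Proof.
move=> [w [wS wm <-]] [w' [wS' wn <-]]; exists (w ++ w'); split.
- by move=> s; rewrite mem_cat => /orP[/wS|/wS'].
- by rewrite size_cat leq_add.
- by rewrite big_cat.
Qed.

Lemma gball_le S m n g : (m <= n)%N -> gball S m g -> gball S n g.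
Proof. by move=> mn [w [? wm ?]]; exists w; split=> //; apply: leq_trans mn. Qed.

Lemma gball_split S m n g : gball S (m + n) g ->
  exists h h', [/\ gball S m h, gball S n h' & g = h * h'].
Proof.
move=> [w [wS wn <-]].
exists (\prod_(s <- take m w) s), (\prod_(s <- drop m w) s); split.
- exists (take m w); split=> //; first by move=> s /mem_take/wS.
  by rewrite size_take; case: ltnP.
- exists (drop m w); split=> //; first by move=> s /mem_drop/wS.
  by rewrite size_drop leq_subLR.
- by rewrite -big_cat cat_take_drop.
Qed.

Lemma gball_gen S s : S s -> gball S 1 s.
Proof.
by move=> Ss; exists [:: s]; split=> // [t|]; rewrite ?inE ?big_seq1 // => /eqP->.
Qed.

Lemma symmetricV S s : symmetric_set S -> S s -> S s^-1.
Proof. by move=> symS Ss; rewrite -symS; exists s. Qed.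

Lemma gballV S n g : symmetric_set S -> gball S n g -> gball S n g^-1.
Proof.
move=> symS [w [wS wn <-]]; exists (rev (map (fun s => s^-1) w)); split.
- move=> s; rewrite mem_rev => /mapP[t /wS tS ->]; exact: symmetricV.
- by rewrite size_rev size_map.
- elim: w {wS wn} => [|s w IH]; first by rewrite !big_nil invg1.
  by rewrite map_cons rev_cons -cats1 big_cat IH big_seq1 big_cons invgM.
Qed.

Lemma gballX S m n g : gball S m g -> gball S (m * n) (g ^+ n).
Proof.
move=> Bg; elim: n => [|n IH]; first by rewrite muln0 expg0; apply: gball1.
by rewrite mulnS expgS; apply: gballM.
Qed.

Lemma generates_ball S H h : symmetric_set S -> generates S H ->
  H h <-> exists n, gball S n h.
Proof.
move=> symS <-; split=> [|[n [w [wS _ <-]]] A [[A1 AV] SA]].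
  move=> /(_ [set h | exists n, gball S n h]); apply; split=> [|s Ss]; last first.
    by exists 1%N; apply: gball_gen.
  split=> [|x y [n xn] [m ym]]; first by exists 0%N; apply: gball1.
  by exists (n + m)%N; apply: gballM => //; apply: gballV.
have Am x y : A x -> A y -> A (x * y).
  move=> Ax Ay; have := AV _ _ A1 Ay; rewrite mul1g => /(AV _ _ Ax).
  by rewrite invgK.
elim: w wS => [|s w IH] wS; first by rewrite big_nil.
rewrite big_cons; apply: Am; first by apply: SA; apply: wS; rewrite mem_head.
by apply: IH => t tw; apply: wS; rewrite inE tw orbT.
Qed.

Lemma gball_finite S n : finite_set S -> finite_set (gball S n).
Proof.
move=> finS; elim: n => [|n IH].
  apply: sub_finite_set (finite_set1 1) => g [w [_]].
  by rewrite leqn0 size_eq0 => /eqP-> <-; rewrite big_nil.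
apply: (@sub_finite_set _ _ ([set 1] `|` [set x * y | x in S & y in gball S n])).
  move=> g [[|s w] [wS wn <-]]; first by left; rewrite big_nil.
  right; exists s; first by apply: wS; rewrite mem_head.
  exists (\prod_(t <- w) t); last by rewrite big_cons.
  by exists w; split=> // t tw; apply: wS; rewrite inE tw orbT.
by rewrite finite_setU; split; [exact: finite_set1|exact: finite_image2].
Qed.

Lemma size_leq_card (T : choiceType) (A : set T) (s : seq T) : finite_set A -> uniq s ->
  (forall x, x \in s -> A x) -> (size s <= #|` fset_set A|)%N.
Proof.
move=> finA us sA; apply: uniq_leq_size => // x /sA Ax.
by rewrite in_fset_set // inE.
Qed.

Lemma card_ball_mul S m n : finite_set S ->
  (#|` fset_set (gball S (m + n))| <=
   #|` fset_set (gball S m)| * #|` fset_set (gball S n)|)%N.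
Proof.
move=> finS; have fB k := @gball_finite S k finS.
rewrite -(size_allpairs (fun x y : G => x * y)); apply: uniq_leq_size => // g.
rewrite in_fset_set // inE => /gball_split[x [y [Bx By ->]]].
by apply: allpairs_f; rewrite in_fset_set // inE.
Qed.

Lemma mem_fset_ball S n g : finite_set S ->
  (g \in fset_set (gball S n)) <-> gball S n g.
Proof.
move=> finS; rewrite in_fset_set; last exact: gball_finite.
by split; rewrite inE.
Qed.

(* As long as the generated subgroup is not exhausted, balls strictly grow. *)
Lemma card_ball_gt S H n : finite_set S -> symmetric_set S -> generates S H ->
  infinite_set H -> (n < #|` fset_set (gball S n)|)%N.
Proof.
move=> finS symS genS infH; elim: n => [|n IH].
  apply: (@size_leq_card _ _ [:: 1]) => // [|x]; first exact: gball_finite.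
  by rewrite inE => /eqP->; apply: gball1.
apply: leq_ltn_trans IH _; rewrite ltnNge; apply/negP => le.
(* If the ball of radius [n] does not grow at the next radius, it absorbs all larger balls and [H]
   is finite. *)
have eqB g : gball S n.+1 g -> gball S n g.
  move=> Bg; apply/(mem_fset_ball n g finS); apply/negP => /negP Bg'.
  have sub : {subset g :: enum_fset (fset_set (gball S n)) <= fset_set (gball S n.+1)}.
    move=> h; rewrite inE => /orP[/eqP->|]; first by apply/mem_fset_ball.
    by move=> /(mem_fset_ball n h finS) Bh; apply/mem_fset_ball => //; apply: gball_le Bh.
  have := uniq_leq_size _ sub; rewrite cons_uniq Bg' fset_uniq => /(_ isT).
  by rewrite ltnNge le.
have allB k g : gball S k g -> gball S n g.
  elim: k g => [|k IHk] g; first by apply: gball_le.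
  rewrite -addn1 => /gball_split[x [y [/IHk Bx By ->]]].
  by apply: eqB; rewrite -addn1; apply: gballM.
apply: infH; apply: sub_finite_set (gball_finite n finS) => h.
by move=> /(generates_ball h symS genS)[k]; apply: allB.
Qed.

(** Only words of equal length are compared, which is enough to count [2 ^ n] elements. *)
Definition free_pair u v := forall (s t : seq bool), size s = size t ->
  (\prod_(c <- s) (if c then u else v))%g = (\prod_(c <- t) (if c then u else v))%g ->
  s = t.

Lemma card_ball_free S L u v n : finite_set S -> gball S L u -> gball S L v ->
  free_pair u v -> (2 ^ n <= #|` fset_set (gball S (n * L))|)%N.
Proof.
move=> finS Bu Bv free; pose f (t : n.-tuple bool) := \prod_(c <- t) (if c then u else v).
have <- : size (map f (enum {: n.-tuple bool})) = (2 ^ n)%N.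
  by rewrite size_map -cardE card_tuple card_bool.
apply: size_leq_card; first exact: gball_finite.
  rewrite map_inj_uniq ?enum_uniq // => s t /free; rewrite !size_tuple => /(_ erefl).
  exact: val_inj.
have word (t : seq bool) : gball S (size t * L) (\prod_(c <- t) (if c then u else v)).
  elim: t => [|c t IH]; first by rewrite big_nil; apply: gball1.
  by rewrite big_cons mulSn; apply: gballM => //; case: c.
by move=> _ /mapP[t _ ->]; have := word t; rewrite size_tuple.
Qed.

End Words.

(** * Growth rates and free pairs *)

Section GrowthRate.
Variables (R : realType) (G : groupType).
Implicit Types (S H : set G) (u v : G).

Lemma word_ballE H S n : sym_gen_set H S -> word_ball R H S n = gball S n.
Proof.
move=> [finS symS genS]; apply/seteqP; split=> g.
  move=> [Hg]; rewrite /word_dist invg1 mul1g => dist; apply: contrapT => nB.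
  (* A word for [g] is needed: the infimum over the empty set is 0 and would give no
     contradiction. *)
  have [m [w [wS _ wg]]] := (generates_ball g symS genS).1 Hg.
  have : n.+1%:R <= inf [set ((size w)%:R : R) | w in words S g].
    apply: lb_le_inf; first by exists (size w)%:R, w.
    move=> _ [w' [w'S w'g] <-]; rewrite ler_nat ltnNge; apply/negP => w'n.
    by apply: nB; exists w'.
  by move=> /le_trans/(_ dist); rewrite ler_nat ltnn.
move=> Bg; split; first by apply/(generates_ball g symS genS); exists n.
case: Bg => w [wS wn wg]; rewrite /word_dist invg1 mul1g.
apply: (@le_trans _ _ (size w)%:R); last by rewrite ler_nat.
apply: ge_inf; last by exists w.
by exists 0 => _ [w' _ <-].
Qed.

(** The logarithm [w] of the ball size is subadditive, so the limit exists, and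
    [n * ln 2 <= w (n * L) <= L * w n] bounds every ratio with [n] positive. *)
Lemma growth_rate_ge H S (L : nat) u v : (0 < L)%N -> sym_gen_set H S ->
  gball S L u -> gball S L v -> free_pair u v ->
  ln 2 / L%:R <= growth_rate R H S.
Proof.
move=> L0 SH Bu Bv free; case: (SH) => finS symS genS.
pose b n := #|` fset_set (gball S n)|; pose w n : R := ln (b n)%:R.
have b_gt0 n : (0 < b n)%N.
  apply: (@size_leq_card _ _ [:: 1%g]) => // [|x]; first exact: gball_finite.
  by rewrite inE => /eqP->; apply: gball1.
have b_pos n : (b n)%:R \is @Num.pos R by rewrite posrE ltr0n.
have w_ge0 n : 0 <= w n by rewrite ln_ge0 // ler1n.
have wD m n : w (m + n)%N <= w m + w n.
  rewrite /w -lnM // -natrM ler_ln ?posrE ?ltr0n ?muln_gt0 ?b_gt0 // ler_nat.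
  exact: card_ball_mul.
have -> : growth_rate R H S = limn (fun n => w n / n%:R : R).
  by rewrite /growth_rate; congr (limn _); apply/funext => n; rewrite word_ballE.
have w0 : w 0%N = 0.
  have -> : w 0%N = ln (1%:R : R); last by rewrite ln1.
  congr (ln _%:R); apply/eqP; rewrite eqn_leq b_gt0 andbT.
  apply: (@uniq_leq_size _ _ [:: 1%g]) => [|g]; first exact: fset_uniq.
  move=> /(mem_fset_ball 0 g finS)[[|s t] [_ wn <-]] //.
  by rewrite big_nil inE.
have L0' : 0 < L%:R :> R by rewrite ltr0n.
apply: limr_ge; first exact: fekete.
near=> n; have n0 : (0 < n)%N by near: n; exists 1%N.
have n0' : 0 < n%:R :> R by rewrite ltr0n.
have h1 : n%:R * ln 2 <= w (n * L)%N.
  rewrite mulr_natl -lnXn // -natrX ler_ln ?posrE ?ltr0n ?expn_gt0 // ler_nat.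
  exact: card_ball_free free.
have h2 := subadditive_mul wD n L.
rewrite mulnC w0 in h2.
rewrite ler_pdivlMr // mulrAC ler_pdivrMr // [ln 2 * _]mulrC [w n * _]mulrC.
lra.
Unshelve. all: by end_near.
Qed.

End GrowthRate.

(** * Isometries translating quasi-axes *)

Section IsometricActions.
Variables (R : realType) (G : groupType) (X : metricType R).
Variables (act : G -> X -> X) (delta : R).
Hypotheses (isom : isometric_action act) (hypX : hyperbolic_with X delta).
Implicit Types (x y z : X) (a b : int -> X) (g h s u v : G) (l : R).

Local Notation d := (@mdist R X).
Local Notation gp := (@gromov_product R X).

Lemma act1 x : act 1%g x = x. Proof. by case: isom. Qed.

Lemma actM g h x : act (g * h)%g x = act g (act h x).
Proof. by case: isom. Qed.

Lemma act_dist g x y : d (act g x) (act g y) = d x y.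
Proof. by case: isom. Qed.

Lemma actK g x : act g^-1%g (act g x) = x.
Proof. by rewrite -actM mulVg act1. Qed.

Lemma actVK g x : act g (act g^-1%g x) = x.
Proof. by rewrite -actM mulgV act1. Qed.

Definition translates g a (n : int) := forall i, act g (a i) = a (i + n).

Lemma translatesV g a n : translates g a n -> translates g^-1%g a (- n).
Proof. by move=> ga i; rewrite -[in LHS](subrK n i) -ga actK. Qed.

Lemma translates_flip g a n : translates g a n -> translates g^-1%g (flip a) n.
Proof.
move=> ga i; rewrite /flip (translatesV ga).
by rewrite (_ : - i - n = - (i + n)) //; lia.
Qed.

Lemma translatesX g a n m : translates g a n -> translates (g ^+ m)%g a (n *+ m).
Proof.
move=> ga; elim: m => [|m IH] i; first by rewrite expg0 act1 addr0.
by rewrite expgS actM IH ga mulrSr addrA.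
Qed.

Lemma translates_conj s g a n : translates g a n ->
  translates (s * g * s^-1)%g (act s \o a) n.
Proof. by move=> ga i /=; rewrite !actM actK ga. Qed.

Lemma axis_act l a s : axis delta l a -> axis delta l (act s \o a).
Proof. by case=> ? a1 a2; split=> // i /=; rewrite act_dist. Qed.

Lemma halfspace_translates g a n i z : translates g a n ->
  halfspace a i z -> halfspace a (i + n) (act g z).
Proof.
move=> ga; rewrite /halfspace /= => H.
rewrite (_ : i + n - 1 = i - 1 + n); last by lia.
by rewrite -!ga !act_dist.
Qed.

Definition orbit_seq g x (i : int) : X :=
  match i with Posz n => act (g ^+ n)%g x | Negz n => act (g^-1 ^+ n.+1)%g x end.

Lemma orbit_seq_translates g x : translates g (orbit_seq g x) 1.
Proof.
case=> [n|[|n]].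
- rewrite (_ : n%:Z + 1 = n.+1%:Z) /=; last by lia.
  by rewrite expgS actM.
- rewrite (_ : Negz 0 + 1 = 0%:Z) /=; last by lia.
  by rewrite expg1 actVK act1.
- rewrite (_ : Negz n.+1 + 1 = Negz n) /=; last by lia.
  by rewrite expgS actM actVK.
Qed.

(** The product bound says that the orbit does not backtrack at [x]; powers of [g] carry this to
    every point of the orbit. *)
Lemma orbit_seq_axis g x : 1000 * delta <= d x (act g x) ->
  gp x (act g x) (act g^-1%g x) <= 8 * delta ->
  axis delta (d x (act g x)) (orbit_seq g x).
Proof.
move=> l_ge gpx; set a := orbit_seq g x.
have a0 : a 0 = x by rewrite /a /= expg0 act1.
have ga : translates g a 1 by exact: orbit_seq_translates.
have shift i : exists h, forall j, a (j + i) = act h (a j).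
  case: i => n.
    exists (g ^+ n)%g => j; rewrite (translatesX n ga).
    by rewrite (_ : j + 1 *+ n = j + n%:Z) //; lia.
  exists (g^-1 ^+ n.+1)%g => j; rewrite (translatesX n.+1 (translatesV ga)).
  by rewrite (_ : j + (- 1) *+ n.+1 = j + Negz n) //; lia.
have e1 : act g x = a 1 by have := ga 0; rewrite a0 add0r.
split=> // i.
  have [h hP] := shift i; have := hP 0; have := hP 1.
  by rewrite add0r [1 + i]addrC => -> ->; rewrite act_dist a0 e1.
have [h hP] := shift (i + 1); have := hP 1; have := hP (- 1).
rewrite (_ : - 1 + (i + 1) = i); last by lia.
rewrite (_ : 1 + (i + 1) = i + 2); last by lia.
move=> -> ->; rewrite act_dist -e1.
have -> : a (- 1) = act g^-1%g x.
  by have := translatesV ga 0; rewrite a0 add0r => ->.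
move: gpx; rewrite /gromov_product (mdistC (act g^-1%g x)).
have : d x (act g^-1%g x) = d x (act g x) by rewrite -(act_dist g) actVK mdistC.
by move=> -> ?; lra.
Qed.

(** * Free semigroups *)

(** The first letter of a word is read off from the set to which the word sends [z]; cancel it and
    induct. *)
Lemma pingpong_free_pair u v (U V : set X) z :
  (forall y, (U `|` V) y -> U (act u y)) -> (forall y, (U `|` V) y -> V (act v y)) ->
  U `&` V = set0 -> U z -> free_pair u v.
Proof.
move=> uU vV UV Uz.
have inUV (s : seq bool) : (U `|` V) (act (\prod_(c <- s) (if c then u else v))%g z).
  elim: s => [|c s IH]; first by rewrite big_nil act1; left.
  by rewrite big_cons actM; case: c; [left; apply: uU|right; apply: vV].
have disj y : U y -> V y -> False by move=> Uy Vy; have : (U `&` V) y by []; rewrite UV.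
elim=> [|b s IH] [|c t] //= [st]; rewrite !big_cons.
case: b c => [] [] e.
- by rewrite (IH _ st (mulgI _ _ _ e)).
- exfalso; apply: disj (uU _ (inUV s)) _.
  by rewrite -actM e actM; apply: vV.
- exfalso; apply: disj (uU _ (inUV t)) _.
  by rewrite -actM -e actM; apply: vV.
- by rewrite (IH _ st (mulgI _ _ _ e)).
Qed.

Lemma pingpong_axes_free_pair l a b u v : axis delta l a -> axis delta l b ->
  pingpong a b -> translates u a 9 -> translates v b 9 -> free_pair u v.
Proof.
move=> axa axb [i [h [ab ba disj]]] ua vb.
apply: (@pingpong_free_pair u v _ _ (a (i + 5%:Z)) _ _ disj).
- move=> y Hy; have {}Hy : halfspace a (i - 4%:Z) y.
    case: Hy => [Hy|/ba//].
    rewrite (_ : i - 4%:Z = i + 5%:Z - 9%:Z); last by lia.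
    by apply: (halfspace_shrink hypX _ axa Hy).
  have := halfspace_translates ua Hy.
  by rewrite (_ : i - 4%:Z + 9 = i + 5%:Z) //; lia.
- move=> y Hy; have {}Hy : halfspace b (h - 4%:Z) y.
    case: Hy => [/ab//|Hy].
    rewrite (_ : h - 4%:Z = h + 5%:Z - 9%:Z); last by lia.
    by apply: (halfspace_shrink hypX _ axb Hy).
  have := halfspace_translates vb Hy.
  by rewrite (_ : h - 4%:Z + 9 = h + 5%:Z) //; lia.
case: hypX => d0 _; case: axa => l_ge a1 _; rewrite /halfspace /= mdistxx.
have := a1 (i + 5%:Z - 1); rewrite subrK mdistC => ->; lra.
Qed.

(** The conjugate of [g] by [s] translates the image axis; flipping an axis replaces [g] by its
    inverse. *)
Lemma axes_free_pair l a g s : axis delta l a -> translates g a 1 ->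
  ~ (forall N, exists j : int, d (a N) (act s (a j)) <= 20 * l) ->
  exists u v, [/\ u = (g ^+ 9)%g \/ u = (g^-1 ^+ 9)%g,
    v = (s * g ^+ 9 * s^-1)%g \/ v = (s * g^-1 ^+ 9 * s^-1)%g & free_pair u v].
Proof.
move=> axa ga nclose; have axb := axis_act s axa.
have [//|[a' [b' [ha hb pp]]]] := axis_dichotomy hypX axa axb.
have g9 : translates (g ^+ 9)%g a 9 by exact: (translatesX 9 ga).
have gV9 : translates (g^-1 ^+ 9)%g (flip a) 9.
  exact: (translatesX 9 (translates_flip ga)).
have [u [uE axa' ua]] : exists u, [/\ u = (g ^+ 9)%g \/ u = (g^-1 ^+ 9)%g,
    axis delta l a' & translates u a' 9].
  case: ha => ->; [exists (g ^+ 9)%g|exists (g^-1 ^+ 9)%g]; split=> //; auto.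
  exact: (axis_flip hypX).
have [v [vE axb' vb]] : exists v,
    [/\ v = (s * g ^+ 9 * s^-1)%g \/ v = (s * g^-1 ^+ 9 * s^-1)%g,
    axis delta l b' & translates v b' 9].
  case: hb => ->; [exists (s * g ^+ 9 * s^-1)%g|exists (s * g^-1 ^+ 9 * s^-1)%g].
    by split; auto; apply: translates_conj.
  split; [by right|exact: (axis_flip hypX)|exact: (translates_conj s gV9)].
exists u, v; split=> //; exact: (pingpong_axes_free_pair axa' axb' pp ua vb).
Qed.

(** * Producing a quasi-axis *)

(* If no element of [T] or [T * T] admits a quasi-axis, all the [t x] and [t^-1 x] with
   almost maximal displacement lie in a common direction from [x]; moving
   [x] in that direction decreases the maximal displacement. *)
Lemma displacement_descent (T : set G) x (A : R) :
  (forall t, T t -> T t^-1%g) ->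
  (forall y, exists2 t, T t & 1100 * delta < d y (act t y)) ->
  geodesic_space X ->
  (forall g, T g \/ (exists s t, [/\ T s, T t & g = (s * t)%g]) ->
     1000 * delta <= d x (act g x) ->
     8 * delta < gp x (act g x) (act g^-1%g x)) ->
  (forall t, T t -> d x (act t x) <= A) ->
  exists y, forall t, T t -> d y (act t y) <= A - delta.
Proof.
move=> TV big geo noax xA; have [d0 _] := hypX.
have A_gt : 1100 * delta < A.
  by have [t Tt /lt_le_trans] := big x; apply; apply: xA.
have dV t : d x (act t^-1%g x) = d x (act t x) by rewrite -(act_dist t) actVK mdistC.
(* If no displacement exceeds [A - 11 * delta], then [x] itself will do. *)
have [[t0 [Tt0 big0]]|small] :=
  pselect (exists t0, T t0 /\ A - 11 * delta < d x (act t0 x)); last first.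
  exists x => t Tt; rewrite leNgt; apply/negP => H; apply: small; exists t.
  by split=> //; lra.
(* Otherwise [t * t0] moves [x] far; its image of [x] lies in the direction of [t x], that of its
   inverse in the direction of [t0^-1 x], and these two directions differ by [e1]. So [t * t0] would
   admit a quasi-axis. *)
have dir t : T t -> A - 11 * delta < d x (act t x) ->
    5 * delta <= gp x (act t x) (act t0 x).
  move=> Tt tbig; rewrite leNgt; apply/negP => small.
  have n1 := noax t (or_introl Tt) ltac:(lra).
  have n0 := noax t0 (or_introl Tt0) ltac:(lra).
  have e1 : gp x (act t x) (act t0^-1%g x) < 6 * delta.
    have := gp_hyp hypX x (act t x) (act t0^-1%g x) (act t0 x).
    by rewrite (gpC x (act t0^-1%g x)); case=> ?; lra.
  have e2 : gp x (act t^-1%g x) (act t0 x) < 6 * delta.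
    have := gp_hyp hypX x (act t x) (act t^-1%g x) (act t0 x).
    by case=> ?; lra.
  have dg : d x (act (t * t0)%g x) =
      d x (act t x) + d x (act t0 x) - 2 * gp x (act t^-1%g x) (act t0 x).
    rewrite actM -(act_dist t^-1%g) actK /gromov_product dV; lra.
  have ng : 8 * delta < gp x (act (t * t0)%g x) (act (t * t0)^-1%g x).
    by apply: noax; [right; exists t, t0|lra].
  have e3 : A - 23 * delta <= gp x (act t x) (act (t * t0)%g x).
    by rewrite /gromov_product dg actM act_dist; lra.
  have e4 : A - 23 * delta <= gp x (act t0^-1%g x) (act (t * t0)^-1%g x).
    rewrite /gromov_product dV dV dg invgM actM act_dist dV; lra.
  have := gp_hyp hypX x (act t x) (act (t * t0)%g x) (act t0^-1%g x).
  have := gp_hyp hypX x (act (t * t0)%g x) (act (t * t0)^-1%g x) (act t0^-1%g x).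
  rewrite (gpC x (act (t * t0)^-1%g x) (act t0^-1%g x)).
  by case=> ? [] ?; lra.
have [c [c0 cD cd]] := geo x (act t0 x); set D := d x (act t0 x) in cD cd big0.
(* Moving by [5 * delta] adds at most [10 * delta] to any displacement, hence the threshold
   [A - 11 * delta]. *)
pose y := c (5 * delta).
have dxy : d x y = 5 * delta.
  by rewrite -{1}c0 cd ?ler0n ?lexx /=; try lra; rewrite sub0r normrN gtr0_norm; lra.
have dyt0 : d y (act t0 x) = D - 5 * delta.
  rewrite -cD cd; try lra.
  by rewrite distrC gtr0_norm; lra.
have gy0 : gp x y (act t0 x) = 5 * delta by rewrite /gromov_product dyt0 dxy -/D; lra.
exists y => t Tt; have [small|tbig] := leP (d x (act t x)) (A - 11 * delta).
  have := mdist_tri x y (act t y); have := mdist_tri (act t x) x (act t y).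
  by rewrite act_dist (mdistC y x); lra.
have gy1 : 4 * delta <= gp x y (act t x).
  have := dir t Tt tbig; have := gp_hyp hypX x y (act t0 x) (act t x).
  by rewrite (gpC x (act t0 x)); case=> ?; lra.
have gy2 : 3 * delta <= gp x y (act t^-1%g x).
  have := noax t (or_introl Tt) ltac:(lra).
  have := gp_hyp hypX x y (act t x) (act t^-1%g x).
  by case=> ?; lra.
have d1 : d y (act t x) <= d x (act t x) - 3 * delta.
  by move: gy1; rewrite /gromov_product dxy; lra.
have d2 : d x (act t y) <= d x (act t x) - delta.
  rewrite -(act_dist t^-1%g) actK mdistC.
  by move: gy2; rewrite /gromov_product dxy dV; lra.
(* The sum of the displacements of [y] and [x] is at most [12 * delta] or twice that of [x] less
   [2 * delta]. *)
have := xA t Tt; have := four_point hypX y x (act t y) (act t x).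
by rewrite act_dist (mdistC y x) dxy => -[] ? ?; lra.
Qed.

(** Each descent lowers the bound on the displacements by [delta], so it cannot be repeated more
    than [A / delta] times. *)
Lemma exists_axis_pair (T : set G) x0 (A : R) :
  (forall t, T t -> T t^-1%g) ->
  (forall y, exists2 t, T t & 1100 * delta < d y (act t y)) ->
  geodesic_space X -> (forall t, T t -> d x0 (act t x0) <= A) ->
  exists x g, [/\ T g \/ (exists s t, [/\ T s, T t & g = (s * t)%g]),
    1000 * delta <= d x (act g x) & gp x (act g x) (act g^-1%g x) <= 8 * delta].
Proof.
move=> TV big geo x0A; apply: contrapT => none; have [d0 _] := hypX.
have desc (n : nat) : exists y, forall t, T t -> d y (act t y) <= A - delta * n%:R.
  elim: n => [|n [y yA]]; first by exists x0 => t Tt; rewrite mulr0 subr0; apply: x0A.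
  have [|z zA] := displacement_descent TV big geo _ yA.
    move=> g Tg gbig; rewrite ltNge; apply/negP => ?.
    by apply: none; exists y, g.
  by exists z => t /zA; rewrite -(natr1 n); lra.
have [n] := natr_gt (A / delta); rewrite ltr_pdivrMr // => nA.
have [y yA] := desc n; have [t Tt tbig] := big y.
by have := yA t Tt; have := mdist_ge0 y (act t y); rewrite mulrC; lra.
Qed.

End IsometricActions.

(** * Points of the Gromov boundary *)

Section Ends.
Variables (R : realType) (X : metricType R) (delta : R).
Hypothesis hypX : hyperbolic_with X delta.
Implicit Types (x y z o : X) (u v w : nat -> X) (xi eta : set (nat -> X)).
Implicit Types (a : int -> X) (c : R -> X).

Local Notation d := (@mdist R X).
Local Notation gp := (@gromov_product R X).

Let delta_gt0 : 0 < delta. Proof. by case: hypX. Qed.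

Lemma same_end_at o u v :
  (forall M, exists N, forall i j, (N <= i)%N -> (N <= j)%N -> M <= gp o (u i) (v j)) ->
  same_end u v.
Proof.
move=> H p M; have [N NP] := H (M + d o p); exists N => i j /NP{}NP /NP.
by have := gp_base_diff o p (u i) (v j); lra.
Qed.

Lemma same_end_sym u v : same_end u v -> same_end v u.
Proof.
by move=> H p M; have [N NP] := H p M; exists N => i j iN jN; rewrite gpC; apply: NP.
Qed.

Lemma same_end_trans v u w : same_end u v -> same_end v w -> same_end u w.
Proof.
move=> H1 H2 p M; have [N1 P1] := H1 p (M + delta).
have [N2 P2] := H2 p (M + delta); exists (maxn N1 N2) => i j.
rewrite !geq_max => /andP[i1 i2] /andP[j1 j2].
have m1 := P1 i (maxn N1 N2) i1 (leq_maxl _ _).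
have m2 := P2 (maxn N1 N2) j (leq_maxr _ _) j2.
by have := gp_hyp hypX p (u i) (v (maxn N1 N2)) (w j); case=> ?; lra.
Qed.

Lemma same_end_perturb (D : R) u v w : (forall n, d (u n) (v n) <= D) ->
  same_end u w -> same_end v w.
Proof.
move=> uv H p M; have [N NP] := H p (M + D); exists N => i j iN jN.
have := NP i j iN jN; have := gp_diff p (w j) (u i) (v i).
by rewrite !(gpC p (w j)); have := uv i; lra.
Qed.

Lemma gromov_unbounded u o (M : R) : gromov_sequence u ->
  exists N, forall n, (N <= n)%N -> M <= d o (u n).
Proof.
by move=> H; have [N NP] := H o M; exists N => n nN; rewrite -gpxx; apply: NP.
Qed.

Lemma boundary_memE xi u v : boundary X xi -> xi u ->
  xi v <-> gromov_sequence v /\ same_end u v.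
Proof.
move=> [w gw ->] [gu wu]; split=> [[gv wv]|[gv uv]]; split=> //.
  exact: same_end_trans (same_end_sym wu) wv.
exact: same_end_trans wu uv.
Qed.

Lemma boundary_gromov xi u : boundary X xi -> xi u -> gromov_sequence u.
Proof. by move=> [w gw ->] []. Qed.

Lemma boundary_eq xi eta u v : boundary X xi -> boundary X eta ->
  xi u -> eta v -> same_end u v -> xi = eta.
Proof.
move=> bxi beta xiu etav uv; apply/seteqP; split=> w.
  move=> /(boundary_memE w bxi xiu)[gw uw]; apply/(boundary_memE w beta etav).
  by split=> //; apply: same_end_trans (same_end_sym uv) uw.
move=> /(boundary_memE w beta etav)[gw vw]; apply/(boundary_memE w bxi xiu).
by split=> //; apply: same_end_trans uv vw.
Qed.

Lemma axis_gp_ge l a (p q : nat) : axis delta l a ->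
  d (a 0) (a p) - 10 * delta <= gp (a 0) (a p) (a q) \/
  d (a 0) (a q) - 10 * delta <= gp (a 0) (a p) (a q).
Proof.
move=> axa; wlog pq : p q / (p <= q)%N.
  by move=> H; case: (leqP p q) => [/H//|/ltnW/H]; rewrite (gpC _ (a q)) => -[]; auto.
left; have := axis_between hypX p%:Z p (q - p) axa.
rewrite subrr (_ : p%:Z + (q - p)%N%:Z = q%:Z); last by lia.
by rewrite (gp_swap (a 0)); lra.
Qed.

Lemma same_end_half_axis l a u (f : nat -> int) (D : R) (N0 : nat) : axis delta l a ->
  gromov_sequence u -> (forall n, d (u n) (a (f n)) <= D) ->
  (forall n, (N0 <= n)%N -> 0 <= f n) -> same_end u (fun n => a n%:Z).
Proof.
move=> axa gu uf f0; apply: (@same_end_at (a 0)) => M; have d0 := delta_gt0.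
have [N1 P1] := gromov_unbounded (a 0) (M + 2 * D + 10 * delta) gu.
have k0 : 0 < l - 18 * delta by case: axa => l_ge _ _; lra.
have [N2] := natr_gt ((M + D + 10 * delta) / (l - 18 * delta)).
rewrite ltr_pdivrMr // => P2.
exists (maxn N0 (maxn N1 N2)) => i j.
rewrite !geq_max => /and3P[i0 i1 i2] /and3P[j0 j1 j2].
have d1 : M + D + 10 * delta <= d (a 0) (a (f i)).
  have := P1 i i1; have := mdist_tri (a (f i)) (a 0) (u i).
  by rewrite (mdistC (a (f i))); have := uf i; lra.
have d2 : M + D + 10 * delta <= d (a 0) (a j).
  have := axis_dist_lb hypX axa 0 j; rewrite add0r.
  have : N2%:R * (l - 18 * delta) <= (l - 18 * delta) * j%:R.
    by rewrite mulrC ler_pM2l // ler_nat.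
  lra.
have [p fp] : exists p : nat, f i = p%:Z by exists (absz (f i)); have := f0 i i0; lia.
have := gp_diff (a 0) (a j) (a (f i)) (u i); rewrite !(gpC _ (a j)).
rewrite (mdistC (a (f i))); have := uf i; rewrite fp in d1 *.
by case: (axis_gp_ge p j axa) => ? ? ?; lra.
Qed.

Lemma same_end_axis l a u (D : R) : axis delta l a -> gromov_sequence u ->
  (forall n, exists i, d (u n) (a i) <= D) ->
  same_end u (fun n => a n%:Z) \/ same_end u (fun n => a (- n%:Z)).
Proof.
move=> axa gu /choice[f fD]; have d0 := delta_gt0.
(* Points on opposite sides of [a 0] have product at most [10 * delta], and replacing two terms of
   [u] by axis points costs [2 * D]; so the tail of [u] stays on one side. *)
have [N0 NP] := gu (a 0) (11 * delta + 2 * D).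
have sgn n m : (N0 <= n)%N -> (N0 <= m)%N -> 0 <= f n -> 0 <= f m.
  move=> nN mN fn; rewrite leNgt; apply/negP => fm.
  have [p pE] : exists p : nat, f n = p%:Z by exists (absz (f n)); lia.
  have [q qE] : exists q : nat, f m = - q%:Z by exists (absz (f m)); lia.
  have := axis_between hypX 0 q p axa; rewrite sub0r add0r -pE -qE.
  have := NP m n mN nN; have := fD n; have := fD m.
  have := gp_diff (a 0) (u n) (u m) (a (f m)).
  have := gp_diff (a 0) (a (f m)) (u n) (a (f n)).
  rewrite !(gpC _ (u n)); clear fn fm; lra.
case: (leP 0 (f N0)) => [f0|f0].
  left; apply: (same_end_half_axis (f := f) (N0 := N0) axa gu fD) => n nN.
  exact: sgn (leqnn _) nN f0.
right; apply: (same_end_half_axis (f := fun n => - f n) (N0 := N0) (axis_flip hypX axa) gu).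
  by move=> n; rewrite /flip opprK.
move=> n nN; rewrite oppr_ge0 leNgt; apply/negP => /ltW fn.
by have := sgn _ _ nN (leqnn _) fn; rewrite leNgt f0.
Qed.

(** * Horoballs *)

Lemma busemann_cvg c x : geodesic_ray c ->
  (d x (c t) - t : R) @[t --> +oo] --> busemann c x.
Proof.
move=> ray; pose f t := d x (c t) - t.
(* A ray is controlled only for nonnegative times, hence the truncation; there [f] is nonincreasing
   and bounded below. *)
pose g t := - f (Num.max t 0).
have fh s t : 0 <= s -> s <= t -> f t <= f s.
  move=> s0 st; have := mdist_tri (c s) x (c t); rewrite ray //; last exact: le_trans st.
  by rewrite distrC ger0_norm ?subr_ge0 // /f; lra.
have gh : {homo g : s t / s <= t}.
  move=> s t st; rewrite /g lerN2; apply: fh; first by rewrite le_max lexx orbT.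
  by rewrite ge_max !le_max st lexx !orbT.
have gub : has_ubound (range g).
  exists (d x (c 0)) => _ [t _ <-]; rewrite /g /f.
  have m0 : 0 <= Num.max t 0 by rewrite le_max lexx orbT.
  have := mdist_tri x (c 0) (c (Num.max t 0)).
  by rewrite ray // sub0r normrN ger0_norm // (mdistC (c 0)); lra.
have : f t @[t --> +oo] --> - sup (range g).
  apply: cvg_trans (cvgN (nondecreasing_cvgr gh gub)).
  apply: near_eq_cvg; near=> t; rewrite /= /g opprK.
  rewrite (_ : Num.max t 0 = t) //; apply/max_idPl.
  by near: t; apply: nbhs_pinfty_ge.
by move=> H; rewrite /busemann (cvg_lim _ H).
Unshelve. all: by end_near.
Qed.

Lemma busemann_lt_eventually c x (C : R) : geodesic_ray c -> busemann c x < C ->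
  exists t0, forall t, t0 < t -> d x (c t) - t < C.
Proof.
by move=> ray /(cvgr_lt _ (busemann_cvg (x := x) ray))[t0 [_ H]]; exists t0.
Qed.

Lemma busemann_ray c (s : R) : geodesic_ray c -> 0 <= s -> busemann c (c s) = - s.
Proof.
move=> ray s0; have H : (d (c s) (c t) - t : R) @[t --> +oo] --> - s.
  apply: cvg_near_cst; near=> t.
  have st : s <= t by near: t; apply: nbhs_pinfty_ge; apply: num_real.
  rewrite ray //.
  by rewrite distrC ger0_norm ?subr_ge0 //; lra.
by rewrite /busemann (cvg_lim _ H).
Unshelve. all: by end_near.
Qed.

Lemma horoball_nonempty xi (U : set X) : open_horoball xi U -> exists y, U y.
Proof.
move=> [_ [c [[ray _] [C [inU _]]]]]; exists (c (`|C| + 1)); apply: inU => /=.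
rewrite (busemann_ray ray) ?ltrN2; last by have := normr_ge0 C; lra.
by have := ler_norm C; lra.
Qed.

(** For a point of [U], the product with [c t] based at [c 0] is, for large [t], at least half of
    its distance to [c 0] minus [C]; this distance tends to infinity along [v]. *)
Lemma horoball_end xi (U : set X) v : open_horoball xi U -> gromov_sequence v ->
  (forall n, U (v n)) -> exists2 w, xi w & same_end v w.
Proof.
move=> [_ [c [[ray xic] [C [_ Uin]]]]] gv vU; exists (fun n => c n%:R) => //.
apply: (@same_end_at (c 0)) => M; have d0 := delta_gt0.
have [N1 P1] := gromov_unbounded (c 0) (2 * (M + delta) + C) gv.
have [N2 P2] := natr_gt (M + delta).
exists (maxn N1 N2) => i j; rewrite !geq_max => /andP[i1 i2] /andP[j1 j2].
have [t0 tP] := busemann_lt_eventually ray (Uin _ (vU i)).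
have [t [tj tt]] : exists t : R, j%:R <= t /\ t0 < t.
  by exists (Num.max (t0 + 1) j%:R); rewrite le_max lt_max lexx orbT ltrDl ltr01.
have j0 : 0 <= j%:R :> R by rewrite ler0n.
have t_ge0 := le_trans j0 tj.
have c0t : d (c 0) (c t) = t by rewrite ray // sub0r normrN ger0_norm.
have c0j : d (c 0) (c j%:R) = j%:R by rewrite ray // sub0r normrN ger0_norm.
have g1 : M + delta <= gp (c 0) (v i) (c t).
  by rewrite /gromov_product c0t; have := tP t tt; have := P1 i i1; lra.
have g2 : M + delta <= gp (c 0) (c t) (c j%:R).
  rewrite /gromov_product c0t c0j ray // ger0_norm ?subr_ge0 //.
  have : N2%:R <= j%:R :> R by rewrite ler_nat.
  lra.
by have := gp_hyp hypX (c 0) (v i) (c t) (c j%:R); case=> ?; lra.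
Qed.

End Ends.

(** * Limit sets of subgroups *)

Section LimitSets.
Variables (R : realType) (G : groupType) (X : metricType R).
Variables (act : G -> X -> X) (delta : R).
Hypotheses (isom : isometric_action act) (hypX : hyperbolic_with X delta).
Implicit Types (x y z : X) (H : set G) (xi : set (nat -> X)).

Local Notation d := (@mdist R X).
Local Notation gp := (@gromov_product R X).

Lemma limit_set_orbit H xi x : limit_set act H xi ->
  exists h : nat -> G, (forall n, H (h n)) /\ xi (fun n => act (h n) x).
Proof.
move=> [bxi [p [h [hH xih]]]]; exists h; split=> //.
have D n : d (act (h n) p) (act (h n) x) <= d p x by rewrite (act_dist isom).
have gh := boundary_gromov bxi xih.
apply/(boundary_memE hypX _ bxi xih).
have e := same_end_perturb D gh; split; last exact: same_end_sym.
exact: same_end_perturb D (same_end_sym e).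
Qed.

Lemma limit_set_boundary H xi : limit_set act H xi -> boundary X xi.
Proof. by case. Qed.

Lemma limit_set_infinite H xi x : limit_set act H xi -> infinite_set H.
Proof.
move=> xiH /finite_seqP[s sE].
have [h [hH xih]] := limit_set_orbit x xiH.
have [M MP] : exists M, forall g, g \in s -> d x (act g x) <= M.
  elim: {sE} s => [|g s [M MP]]; first by exists 0.
  exists (Num.max M (d x (act g x))) => g'; rewrite inE => /orP[/eqP->|/MP H1].
    by rewrite le_max lexx orbT.
  by rewrite le_max H1.
have [N NP] := gromov_unbounded x (M + 1) (boundary_gromov (limit_set_boundary xiH) xih).
have := NP N (leqnn _); have : h N \in s by have := hH N; rewrite sE.
by move=> /MP; lra.
Qed.

(** Every limit point is one of the two ends of the axis, so two of any three coincide. *)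
Lemma limit_set_near_axis l a (D : R) H xi1 xi2 xi3 x : axis delta l a ->
  (forall h, H h -> exists i, d (act h x) (a i) <= D) ->
  limit_set act H xi1 -> limit_set act H xi2 -> limit_set act H xi3 ->
  [\/ xi1 = xi2, xi2 = xi3 | xi1 = xi3].
Proof.
move=> axa near L1 L2 L3.
have ends xi : limit_set act H xi ->
    exists2 u, xi u & same_end u (fun n => a n%:Z) \/ same_end u (fun n => a (- n%:Z)).
  move=> L; have [h [hH xih]] := limit_set_orbit x L.
  exists (fun n => act (h n) x) => //.
  apply: (same_end_axis hypX axa (boundary_gromov (limit_set_boundary L) xih)) => n.
  exact: near.
have eq xi eta u v w : limit_set act H xi -> limit_set act H eta -> xi u -> eta v ->
    same_end u w -> same_end v w -> xi = eta.
  move=> Lxi Leta xiu etav uw vw.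
  apply: (boundary_eq hypX (limit_set_boundary Lxi) (limit_set_boundary Leta) xiu etav).
  exact: (same_end_trans hypX uw (same_end_sym vw)).
have [u1 x1 e1] := ends _ L1; have [u2 x2 e2] := ends _ L2; have [u3 x3 e3] := ends _ L3.
case: e1 e2 e3 => [e1|e1] [e2|e2] [e3|e3].
- by constructor 1; apply: (eq _ _ _ _ _ L1 L2 x1 x2 e1 e2).
- by constructor 1; apply: (eq _ _ _ _ _ L1 L2 x1 x2 e1 e2).
- by constructor 3; apply: (eq _ _ _ _ _ L1 L3 x1 x3 e1 e3).
- by constructor 2; apply: (eq _ _ _ _ _ L2 L3 x2 x3 e2 e3).
- by constructor 2; apply: (eq _ _ _ _ _ L2 L3 x2 x3 e2 e3).
- by constructor 3; apply: (eq _ _ _ _ _ L1 L3 x1 x3 e1 e3).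
- by constructor 1; apply: (eq _ _ _ _ _ L1 L2 x1 x2 e1 e2).
- by constructor 1; apply: (eq _ _ _ _ _ L1 L2 x1 x2 e1 e2).
Qed.

Lemma limit_set_horoball H xi eta (U : set X) : boundary X xi -> open_horoball xi U ->
  (forall h y, H h -> U y -> U (act h y)) -> limit_set act H eta -> eta = xi.
Proof.
move=> bxi oU HU L; have [y Uy] := horoball_nonempty oU.
have [h [hH etah]] := limit_set_orbit y L.
have [|w xiw hw] := horoball_end hypX oU (boundary_gromov (limit_set_boundary L) etah).
  by move=> n; apply: HU.
exact: (boundary_eq hypX (limit_set_boundary L) bxi etah xiw hw).
Qed.

Lemma non_elementary_three H : non_elementary act H -> exists xi1 xi2 xi3,
  [/\ limit_set act H xi1, limit_set act H xi2 & limit_set act H xi3] /\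
  [/\ xi1 <> xi2, xi2 <> xi3 & xi1 <> xi3].
Proof.
move=> /pcard_leP[f]; exists (f 0%N), (f 1%N), (f 2%N).
have fi n m : (n < 3)%N -> (m < 3)%N -> n <> m -> f n <> f m.
  by move=> n3 m3 nm /inj; rewrite !inE; move=> H1; apply: nm; apply: H1.
by split; split; try (by apply: funS); apply: fi.
Qed.

End LimitSets.

(** * Systems of disjoint open sets in a geodesic space *)

Section HoroballSystems.
Variables (R : realType) (X : metricType R).
Implicit Types (x y z : X) (U V K : set X).

Local Notation d := (@mdist R X).

Lemma compact_mdist_bounded K x : compact K -> exists r, forall y, K y -> d x y <= r.
Proof.
move=> cK; have cd : continuous (d x : X -> R).
  move=> y; apply/cvgrPdist_lt => e e0.
  apply/metricType_numDomainType.nbhs_mdistP; exists e => // z /= yz.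
  apply: le_lt_trans yz; rewrite ler_norml.
  have := mdist_tri z x y; have := mdist_tri y x z; rewrite (mdistC z y).
  by move=> ? ?; apply/andP; split; lra.
have := compact_bounded (continuous_compact (continuous_subspaceT cd) cK).
move=> [M [_ MP]]; exists (M + 1) => y Ky.
apply: le_trans (ler_norm _) (MP (M + 1) _ _ _); first by lra.
by exists y.
Qed.

(** A geodesic from [x] to [y] is connected and covered by disjoint open sets, so it stays in the
    one containing [x]. *)
Lemma geodesic_trapped (UU : set (set X)) U x y (r : R) : geodesic_space X ->
  (forall V, UU V -> open V) ->
  (forall V W, UU V -> UU W -> V <> W -> V `&` W = set0) ->
  (forall z, d x z <= r -> exists2 V, UU V & V z) ->
  UU U -> U x -> d x y <= r -> U y.
Proof.
move=> geo oUU disj cover UUU Ux xy.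
have [c [c0 cD cd]] := geo x y; set D := d x y in xy cD cd.
have D0 : 0 <= D by apply: mdist_ge0.
(* The geodesic is controlled only on [[0, D]]; clamping the parameter makes it continuous on the
   whole line. *)
pose clamp t := Num.min (Num.max t 0) D.
have clampP t : 0 <= clamp t <= D.
  by rewrite /clamp ge_min lexx orbT andbT le_min D0 andbT le_max lexx orbT.
have clampL s t : `|clamp s - clamp t| <= `|s - t|.
  have clampE p : [\/ clamp p = 0 /\ p <= 0, clamp p = p /\ 0 <= p <= D
                   | clamp p = D /\ D <= p].
    rewrite /clamp; have [p0|p0] := leP p 0; first by rewrite min_l //; constructor 1.
    have [pD|/ltW pD] := leP p D; first by constructor 2; rewrite ?pD (ltW p0).
    by constructor 3.
  have := ler_norm (s - t); have := ler_norm (t - s); rewrite (distrC t) ler_norml.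
  move=> ? ?; apply/andP.
  by case: (clampE s) => -[-> ?]; case: (clampE t) => -[-> ?]; split; lra.
have cc : continuous (c \o clamp : R -> X).
  move=> t; apply/metricType_numDomainType.cvgrPdist_lt => e e0.
  exists e => // s /= ts; rewrite cd //; exact: le_lt_trans ts.
pose A := (c \o clamp) @` `[0, D].
have conA : connected A.
  exact: connected_continuous_connected (@segment_connected R 0 D) (continuous_subspaceT cc).
have AU : A `&` U = A.
  apply: conA.
  - exists x; split=> //; exists 0; first by rewrite /= in_itv /= lexx D0.
    by rewrite /= /clamp maxxx min_l.
  - by exists U => //; apply: oUU.
  - exists (~` \bigcup_(V in [set V | UU V /\ V <> U]) V).
      by apply: open_closedC; apply: bigcup_open => V [UUV _]; apply: oUU.
    apply/seteqP; split=> z [Az Uz]; split=> //.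
      move=> [V [UUV VU] Vz]; have : (V `&` U) z by [].
      by rewrite disj.
    have [V UUV Vz] : exists2 V, UU V & V z.
      apply: cover; case: Az => t _ <- /=; rewrite -{1}c0 cd ?lexx ?D0 //.
      rewrite sub0r normrN ger0_norm; last by case/andP: (clampP t).
      by apply: le_trans xy; case/andP: (clampP t).
    have [<-//|VU] := pselect (V = U).
    by exfalso; apply: Uz; exists V.
have : A y.
  exists D; first by rewrite /= in_itv /= lexx D0.
  by rewrite /= /clamp max_l // minxx.
by rewrite -AU => -[].
Qed.

End HoroballSystems.

(** * Uniform displacement for cusp-uniform actions *)

Section CuspUniform.
Variables (R : realType) (G : groupType) (X : metricType R).
Variable (act : G -> X -> X).
Hypothesis cusp : cusp_uniform act.

Local Notation d := (@mdist R X).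

Let isom : isometric_action act. Proof. by case: cusp. Qed.

Lemma cusp_uniform_displacement (L0 : R) : exists M : nat, forall H S,
  sym_gen_set H S -> non_elementary act H ->
  forall y, exists2 t, gball S M t & L0 < d y (act t y).
Proof.
case: cusp => [[proper geo hyp] _ pact _ [UU [parU _ disj UUact] [K [cK KY cov]]]].
have [delta hypX] := gromov_hyperbolic_with hyp.
have [[x0 _]|noX] := pselect (exists x : X, True); last first.
  by exists 0%N => H S _ _ y; case: noX; exists y.
have [r rP] := compact_mdist_bounded x0 cK.
(* [B] contains all points within [2 * L0] of [K]; by properness only finitely many elements move
   [B] to meet itself, and this number gives [M], independently of [H] and [S]. *)
pose B := [set z | d x0 z <= r + 2 * L0].
have fB := pact _ (proper x0 (r + 2 * L0)).
set F := [set g | _] in fB.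
exists #|` fset_set F|.+1 => H S SH neH y; apply: contrapT => small.
set M := #|` fset_set F|.+1 in small.
have {}small t : gball S M t -> d y (act t y) <= L0.
  by move=> Bt; rewrite leNgt; apply/negP => tL; apply: small; exists t.
case: (SH) => finS symS genS.
have [xi1 [xi2 [xi3 [[L1 L2 L3] [n12 _ _]]]]] := non_elementary_three neH.
(* If [y] is close to the cocompact part, conjugation by a suitable [g] embeds the ball of radius
   [M] into [F], which is too small. *)
have [[z [zY yz]]|inU] :=
  pselect (exists z, (~` \bigcup_(U in UU) U) z /\ d y z <= L0).
  have [g [k [Kk gk]]] := cov z zY.
  have fin := gball_finite M finS.
  have : (#|` fset_set (gball S M)| <= #|` fset_set F|)%N.
    rewrite -(size_map (fun t => (g^-1 * t * g)%g)); apply: size_leq_card => //.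
      rewrite map_inj_uniq ?fset_uniq // => s t /(congr1 (fun h => (g * h * g^-1)%g)).
      by rewrite !mulgA !mulgV !mul1g !mulgK.
    move=> _ /mapP[t /(mem_fset_ball M t finS) Bt ->].
    have yk : d k (act g^-1%g y) <= L0.
      by rewrite -(act_dist isom g) (actVK isom) gk mdistC.
    have L0_ge0 : 0 <= L0 by apply: le_trans yz; apply: mdist_ge0.
    exists (act (g^-1 * t)%g y); split.
      exists (act g^-1%g y); last by rewrite !(actM isom) (actVK isom).
      rewrite /=; have := rP k Kk; have := mdist_tri k x0 (act g^-1%g y); lra.
    have := small t Bt; rewrite -(act_dist isom g^-1%g) -(actM isom).
    rewrite /=; have := rP k Kk; have := mdist_tri k x0 (act (g^-1 * t)%g y).
    have := mdist_tri (act g^-1%g y) k (act (g^-1 * t)%g y); lra.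
  have infH := limit_set_infinite isom hypX x0 L1.
  have := card_ball_gt M finS symS genS infH.
  by move=> /leq_trans M_lt /M_lt; rewrite /M ltnNge ltnW.
(* Otherwise horoballs cover the ball of radius [L0] about [y], so [S] keeps [y] inside a single [U]
   and, the system being invariant and disjoint, preserves [U]. *)
have cover z : d y z <= L0 -> exists2 V, UU V & V z.
  move=> yz; apply: contrapT => noV; apply: inU; exists z; split=> //.
have oUU V : UU V -> open V by move=> /parU[xi _ []].
have [U UUU Uy] : exists2 V, UU V & V y.
  have := cover y; rewrite mdistxx; apply.
  by have := small 1%g (gball1 S M); rewrite (act1 isom) mdistxx.
have SU s z : S s -> U z -> U (act s z).
  move=> Ss Uz; have Usy : U (act s y).
    apply: (geodesic_trapped geo oUU disj cover UUU Uy).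
    by apply: small; apply: gball_le (gball_gen Ss).
  have [<-|nU] := pselect (act s @` U = U); first by exists z.
  have : (act s @` U `&` U) (act s y) by split=> //; exists y.
  by rewrite disj //; apply: UUact.
have HU h z : H h -> U z -> U (act h z).
  move=> /(generates_ball h symS genS)[n [w [wS _ <-]]] Uz.
  elim: w wS => [|s w IH] wS; first by rewrite big_nil (act1 isom).
  rewrite big_cons (actM isom); apply: SU; first by apply: wS; rewrite mem_head.
  by apply: IH => t tw; apply: wS; rewrite inE tw orbT.
have [xi par oU] := parU U UUU.
have bxi : boundary X xi.
  have [P _ PE] := par; have : limit_set act P xi by rewrite PE.
  by case.
apply: n12; rewrite (limit_set_horoball isom hypX bxi oU HU L1).
by rewrite (limit_set_horoball isom hypX bxi oU HU L2).
Qed.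

End CuspUniform.

(** * Subgroups that stay near a quasi-axis *)

Section AxisOfSubgroup.
Variables (R : realType) (G : groupType) (X : metricType R).
Variables (act : G -> X -> X) (delta : R).
Hypotheses (isom : isometric_action act) (hypX : hyperbolic_with X delta).

Local Notation d := (@mdist R X).
Local Notation gp := (@gromov_product R X).

(* Only the qualitative closeness of [a] and [s a] is stable under products in
   [s]; since two axes at finite distance are uniformly close, the bound is
   recovered for the whole subgroup. *)
Lemma elementary_of_axis l (a : int -> X) (H S : set G) : axis delta l a ->
  sym_gen_set H S ->
  (forall s, S s -> forall N, exists j : int, d (a N) (act s (a j)) <= 20 * l) ->
  forall h, H h -> exists i, d (act h (a 0)) (a i) <= 3 * l.
Proof.
move=> axa [finS symS genS] close; have [d0 _] := hypX; case: (axa) => l_ge _ _.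
have far h : H h -> exists E, forall N, exists j : int, d (a N) (act h (a j)) <= E.
  move=> /(generates_ball h symS genS)[n [w [wS _ <-]]].
  elim: w wS => [|s w IH] wS.
    by exists 0 => N; exists N; rewrite big_nil (act1 isom) mdistxx.
  have [|E EP] := IH; first by move=> t tw; apply: wS; rewrite inE tw orbT.
  exists (20 * l + E) => N.
  have [i ci] := close s (wS _ (mem_head _ _)) N; have [j cj] := EP i.
  exists j; rewrite big_cons (actM isom); apply: le_trans (mdist_tri (act s (a i)) _ _) _.
  by rewrite (act_dist isom) lerD.
have unif h N : H h -> exists j : int, d (a N) (act h (a j)) <= 3 * l.
  move=> Hh; have [E EP] := far h Hh.
  have k0 : 0 < l - 18 * delta by lra.
  have [n] := natr_gt ((E + 13 * delta) / (l - 18 * delta)).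
  rewrite ltr_pdivrMr // mulrC => nE.
  (* For large [n] the points of the image axis near [a (N - n)] and [a (N + n)] lie in opposite
     directions from [a N], whatever [E] is; so the image axis passes within [12 * delta + 2 * l] of
     [a N]. *)
  have [p pP] := EP (N - n%:Z); have [q qP] := EP (N + n%:Z).
  have e1 := axis_between hypX N n n axa.
  have e2 := axis_dist_lb hypX axa N n; have e3 := axis_dist_lb' hypX axa N n.
  have e4 := gp_diff (a N) (a (N - n%:Z)) (a (N - n%:Z)) (act h (a p)).
  have e5 := gp_diff (a N) (a (N + n%:Z)) (a (N + n%:Z)) (act h (a q)).
  rewrite !gpxx in e4 e5.
  have e6 : gp (a N) (act h (a p)) (act h (a q)) <= 12 * delta.
    have := gp_hyp hypX (a N) (a (N - n%:Z)) (act h (a p)) (a (N + n%:Z)).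
    have := gp_hyp hypX (a N) (act h (a p)) (act h (a q)) (a (N + n%:Z)).
    rewrite (gpC _ (act h (a q)) (a (N + n%:Z))).
    by case=> ? [] ?; lra.
  have [j jP] := near_axis hypX (axis_act isom h axa) e6.
  by exists j; apply: le_trans jP _; lra.
move=> h Hh; have HhV : H h^-1%g.
  have [n Bn] := (generates_ball h symS genS).1 Hh.
  by apply/(generates_ball _ symS genS); exists n; apply: gballV.
have [j jP] := unif _ 0 HhV; exists j.
by rewrite -(act_dist isom h^-1%g) (actK isom).
Qed.

End AxisOfSubgroup.

(** * Uniform exponential growth of non-elementary subgroups *)

Lemma smallest_subgroup (G : groupType) (S : set G) : subgroup (smallest (@subgroup G) S).
Proof.
split=> [A [[]]//|x y Sx Sy A AP]; have [[_ AV] _] := AP.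
exact: AV (Sx A AP) (Sy A AP).
Qed.

(** This makes the set of growth rates nonempty; its infimum would be 0 by convention otherwise. *)
Lemma sym_gen_set_exists (G : groupType) (H : set G) : finitely_generated H ->
  exists S, sym_gen_set H S.
Proof.
move=> [S finS <-]; exists (S `|` [set s^-1%g | s in S]); split.
- by rewrite finite_setU; split=> //; apply: finite_image.
- apply/seteqP; split=> [_ [s [Ss|[t St <-]] <-]|s [Ss|[t St <-]]].
  + by right; exists s.
  + by left; rewrite invgK.
  + by exists s^-1%g; [right; exists s|rewrite invgK].
  + by exists t => //; left.
- apply/seteqP; split; last first.
    by apply: sub_smallest2r; [apply: smallest_subgroup|move=> s Ss; left].
  apply: smallest_sub; first exact: smallest_subgroup.
  have [H1 HV] := smallest_subgroup S.
  move=> s [Ss|[t St <-]]; first exact: sub_gen_smallest.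
  by rewrite -[t^-1%g]mul1g; apply: HV => //; apply: sub_gen_smallest.
Qed.

Theorem theorem1p2 (R : realType) (G : groupType) (X : metricType R)
    (act : G -> X -> X) :
  finitely_generated [set: G] ->
  cusp_uniform act ->
  non_elementary act [set: G] ->
  forall H : set G,
    subgroup H ->
    finitely_generated H ->
    non_elementary act H ->
    0 < inf [set growth_rate R H S | S in [set S : set G | sym_gen_set H S]].
Proof.
move=> _ cusp _ H _ fgH neH.
have [[_ geo hyp] isom _ _ _] := cusp.
have [delta hypX] := gromov_hyperbolic_with hyp.
have [M MP] := cusp_uniform_displacement cusp (1100 * delta).
(* A product of two ball elements, raised to the ninth power and conjugated by a generator, has
   length at most [L]. *)
pose L := (1 + M.+1.*2 * 9 + 1)%N.
have c0 : 0 < ln 2 / L%:R :> R by rewrite divr_gt0 ?ltr0n // ln_gt0 // ltr1n.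
apply: lt_le_trans c0 _; apply: lb_le_inf.
  have [S SH] := sym_gen_set_exists fgH.
  by exists (growth_rate R H S), S.
move=> _ [S SH <-]; case: (SH) => finS symS genS.
have big := MP H S SH neH.
have [x0 _] : exists x : X, True.
  have [xi1 [_ [_ [[L1 _ _] _]]]] := non_elementary_three neH.
  by case: L1 => _ [x [h _]]; exists x.
have [A AP] : exists A, forall t, gball S M t -> mdist x0 (act t x0) <= A.
  have /finite_seqP[s ->] := gball_finite M finS.
  elim: s => [|g s [A AP]]; first by exists 0.
  exists (Num.max A (mdist x0 (act g x0))) => t /=; rewrite inE => /orP[/eqP->|/AP H1].
    by rewrite le_max lexx orbT.
  by rewrite le_max H1.
have [x [g [gS l_ge gpx]]] :=
  exists_axis_pair isom hypX (fun t => @gballV _ S M t symS) big geo AP.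
have Bg : gball S M.+1.*2 g.
  case: gS => [|[s [t [Bs Bt ->]]]]; first by apply: gball_le; lia.
  by apply: gball_le (gballM Bs Bt); lia.
have axa := orbit_seq_axis isom l_ge gpx; set a := orbit_seq act g x in axa.
have ga : translates act g a 1 by apply: orbit_seq_translates.
(* If every generator keeps the axis close to itself, [H] has at most two limit points; otherwise a
   generator [s] moves the axis away and yields a free pair. *)
have [close|/existsNP[s /not_implyP[Ss nclose]]] := pselect
  (forall s, S s -> forall N, exists j : int,
     mdist (a N) (act s (a j)) <= 20 * mdist x (act g x)).
  have near := elementary_of_axis isom hypX axa SH close.
  have [xi1 [xi2 [xi3 [[L1 L2 L3] [n12 n23 n13]]]]] := non_elementary_three neH.
  by case: (limit_set_near_axis isom hypX axa near L1 L2 L3).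
have [u [v [uE vE free]]] := axes_free_pair isom hypX axa ga nclose.
have B9 : gball S (M.+1.*2 * 9) (g ^+ 9)%g by apply: gballX.
have BV9 : gball S (M.+1.*2 * 9) (g^-1 ^+ 9)%g by apply/gballX/gballV.
have conj h : gball S (M.+1.*2 * 9) h -> gball S L (s * h * s^-1)%g.
  move=> Bh; apply: gballM; last by apply: gballV => //; apply: gball_gen.
  by apply: gballM => //; apply: gball_gen.
apply: (@growth_rate_ge R G H S L u v) => //.
- have le : (M.+1.*2 * 9 <= L)%N by rewrite /L; lia.
  by case: uE => ->; apply: gball_le le _.
- by case: vE => ->; apply: conj.
Qed.
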